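(* Consider the trust-region $J$-symmetric quasi-Newton algorithm described in the context, applied to the minimax problem $\min_{x\in\mathbb{R}^n}\max_{w\in\mathbb{R}^m}L(x,w)$ with $L$ three times differentiable. Assume: (a) For any $R_0>0$, $F$ and $\nabla F$ are Lipschitz continuous in $S(R_0)$: there exist constants $\gamma_1,\gamma_2$ such that for all $z,z+s\in S(R_0)$, $\|F(z)-F(z+s)\|\le\gamma_1\|s\|$ and $\|\nabla F(z)-\nabla F(z+s)\|\le\gamma_2\|s\|$. (b) There exists at least one $z^*$ with $F(z^* )=0$; furthermore $\nabla F(z^* )$ is invertible for every saddle point $z^*$ (i.e. every $z^*$ with $F(z^* )=0$), and there exists $\gamma$ with $\gamma\ge\|\nabla F(z^* )^{-1}\|$. (c) The sequence of steps $\{s_k\}$ generated by the algorithm is uniformly linearly independent. Suppose moreover that $\{z_k\}$ converges to a saddle point $z^*$ with $F(z^* )=0$ and that $\{s_k\}$ converges to zero. Then: 1. $\{B_k\}$ converges to $\nabla F(z^* )$. 2. The algorithm converges R-superlinearly to $z^*$, that is, $\lim_{k\to\infty}\|z_k-z^*\|^{1/k}=0$.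
   Context: Notation. $z=(x,w)\in\mathbb{R}^{n+m}$; $F(z)=[\nabla_xL(x,w),-\nabla_wL(x,w)]$; $\nabla F$ is the Jacobian of $F$. $\|\cdot\|$ is the Euclidean/operator norm. $J=\begin{bmatrix} I_{n\times n}&0\\0&-I_{m\times m}\end{bmatrix}$; a matrix $M$ is $J$-symmetric if $M=JM^TJ$. Algorithm. Inputs: $z_0\in\mathbb{R}^{n+m}$; a nonsingular $J$-symmetric $B_0\in\mathbb{R}^{(n+m)\times(n+m)}$; maximal radius $R_0>0$; initial radius $\Delta_0\in(0,R_0]$; $\hat\beta=0.9$; $\zeta\in(0,10^{-3})$. For $k=0,1,2,\ldots$, with $g_k=\nabla F(z_k)^TF(z_k)$ and $$m_k(s)=\tfrac12\|F(z_k)\|^2+g_k^Ts+\tfrac12s^TB_k^TB_ks:$$ 1. Let $p_k^B=-B_k^{-1}(B_k^{-1})^Tg_k$ and $p_k^C=-\min\{\|g_k\|^2/(g_k^TB_k^TB_kg_k),\ \Delta_k/\|g_k\|\}\,g_k$. If $\|p_k^B\|\le\Delta_k$ set $s_k=p_k^B$. Otherwise, if $\|p_k^C\|=\Delta_k$ set $s_k=p_k^C$; and if $\|p_k^C\|<\Delta_k$ set $s_k=p_k^D:=p_k^C+\alpha(p_k^B-p_k^C)$, where $\alpha\in(0,1)$ is the unique value with $\|p_k^C+\alpha(p_k^B-p_k^C)\|=\Delta_k$. 2. Let $\rho_k=\dfrac{\|F(z_k)\|^2/2-\|F(z_k+s_k)\|^2/2}{m_k(0)-m_k(s_k)}$.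 If $\rho_k\le0.5$ set $\Delta_{k+1}=\Delta_k/2$; otherwise set $\Delta_{k+1}=\min\{2\Delta_k,R_0\}$. 3. If $\rho_k\ge\zeta$ set $z_{k+1}=z_k+s_k$ (valid step); otherwise set $z_{k+1}=z_k$ (null step). 4. Let $y_k=F(z_k+s_k)-F(z_k)$ and $$B_{k+1}=B_k+\beta_k\frac{Js_k(y_k-B_ks_k)^TJ+(y_k-B_ks_k)s_k^T}{s_k^Ts_k}-\beta_k^2\frac{(Js_k)^T(y_k-B_ks_k)\,Js_ks_k^T}{(s_k^Ts_k)^2},$$ where $\beta_k$ is drawn uniformly at random from $[1-\hat\beta,1+\hat\beta]$. Given that $B_k$ is nonsingular, $B_{k+1}$ is nonsingular with probability one; the results concern realizations for which every $B_k$ is nonsingular. Level sets. $S=\{z:\|F(z)\|^2/2\le\|F(z_0)\|^2/2\}$ and $S(R_0)=\{z+s:\ \|s\|<R_0,\ z\in S\}$. Uniform linear independence. A sequence of unit vectors $\{u_j\}$ in $\mathbb{R}^{n+m}$ is uniformly linearly independent if there are $\beta>0$, $k_0\ge0$ and $t\ge n+m$ such that for all $k\ge k_0$ and all $\|x\|=1$, $\max\{|\langle x,u_j\rangle|:\ j=k+1,\ldots,k+t\}\ge\beta$. The sequence $\{s_k\}$ is uniformly linearly independent if $s_k\neq0$ for all $k$ and $\{s_k/\|s_k\|\}$ is. *)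

(* Defs.v *)
From HB Require Import structures.
From mathcomp Require Import all_boot all_order all_algebra.
From mathcomp Require Import all_classical all_reals all_analysis.
Import Order.TTheory GRing.Theory Num.Theory.
Import numFieldNormedType.Exports.

Set Implicit Arguments.
Unset Strict Implicit.
Unset Printing Implicit Defensive.

Local Open Scope classical_set_scope.
Local Open Scope ring_scope.

Section Euclidean.
Context {R : realType}.

Definition dotv {N : nat} (u v : 'cV[R]_N) : R := \sum_i u i 0 * v i 0.

(* The norm that the library puts on matrices is the max norm, so the
   Euclidean norm and the operator norm it induces are introduced here.  The
   library topology on vectors and matrices is the usual one, and limits are
   taken in it. *)
Definition enorm {N : nat} (u : 'cV[R]_N) : R := Num.sqrt (dotv u u).

Definition opnorm {M N : nat} (A : 'M[R]_(M, N)) : R :=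
  sup [set enorm (A *m v) | v in [set v : 'cV[R]_N | enorm v <= 1]].

Definition grad {N : nat} (f : 'cV[R]_N -> R) (x : 'cV[R]_N) : 'cV[R]_N :=
  \col_i 'D_(delta_mx i 0) f x.

(* The library's [jacobian] is for row vectors and acts by [v *m jacobian f a];
   transposing gives the usual matrix, with (i, j) entry dF_i/dz_j. *)
Definition jac {N : nat} (F : 'cV[R]_N -> 'cV[R]_N) (z : 'cV[R]_N) : 'M[R]_N :=
  (jacobian (fun u : 'rV[R]_N => (F u^T)^T) z^T)^T.

(* In finite dimension the k-th Frechet derivative exists everywhere iff f is
   differentiable and z |-> 'D_v f z is k - 1 times differentiable for all v. *)
Fixpoint times_differentiable {N : nat} (k : nat) (f : 'cV[R]_N -> R) : Prop :=
  if k is k'.+1 then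
    (forall z, differentiable f z) /\
    (forall v : 'cV[R]_N, times_differentiable k' (fun z => 'D_v f z))
  else True.

(* All values are nonnegative, so 0 is a neutral default for the maximum. *)
Definition uniformly_independent_units {N : nat} (u : nat -> 'cV[R]_N) : Prop :=
  (forall j, enorm (u j) = 1) /\
  exists (b : R) (k0 t : nat),
    [/\ 0 < b, (N <= t)%N &
        forall (k : nat) (x : 'cV[R]_N), (k0 <= k)%N -> enorm x = 1 ->
          b <= \big[Num.max/0]_(k.+1 <= j < (k + t).+1) `|dotv x (u j)|].

Definition uniformly_independent {N : nat} (s : nat -> 'cV[R]_N) : Prop :=
  (forall k, s k != 0) /\
  uniformly_independent_units (fun k => (enorm (s k))^-1 *: s k).

Definition R_superlinear {N : nat} (z : nat -> 'cV[R]_N) (zs : 'cV[R]_N) : Prop :=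
  enorm (z k - zs) `^ (k%:R^-1) @[k --> \oo] --> (0 : R).

Definition level_set {N : nat} (F : 'cV[R]_N -> 'cV[R]_N) (z0 : 'cV[R]_N) :
    set 'cV[R]_N :=
  [set z | enorm (F z) ^+ 2 / 2 <= enorm (F z0) ^+ 2 / 2].

Definition level_nbhd {N : nat} (F : 'cV[R]_N -> 'cV[R]_N) (z0 : 'cV[R]_N)
    (r : R) : set 'cV[R]_N :=
  [set u | exists z s : 'cV[R]_N,
             [/\ u = z + s, enorm s < r & level_set F z0 z]].

Definition lipschitz_on_level_nbhds {N : nat} (F : 'cV[R]_N -> 'cV[R]_N)
    (z0 : 'cV[R]_N) : Prop :=
  forall r : R, 0 < r -> exists g1 g2 : R, forall z s : 'cV[R]_N,
    level_nbhd F z0 r z -> level_nbhd F z0 r (z + s) ->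
    enorm (F z - F (z + s)) <= g1 * enorm s /\
    opnorm (jac F z - jac F (z + s)) <= g2 * enorm s.

Definition regular_saddle_points {N : nat} (F : 'cV[R]_N -> 'cV[R]_N) : Prop :=
  [/\ exists zs, F zs = 0,
      forall zs, F zs = 0 -> jac F zs \in unitmx
    & exists gamma : R, forall zs, F zs = 0 -> opnorm (invmx (jac F zs)) <= gamma].

End Euclidean.

Section Algorithm.
Context {R : realType} {n m : nat}.

Local Notation V := 'cV[R]_(n + m).
Local Notation mat := 'M[R]_(n + m).

Definition uncurryL (L : 'cV[R]_n -> 'cV[R]_m -> R) (z : V) : R :=
  L (usubmx z) (dsubmx z).

Definition minimaxF (L : 'cV[R]_n -> 'cV[R]_m -> R) (z : V) : V :=
  col_mx (grad (fun x => L x (dsubmx z)) (usubmx z))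
         (- grad (fun w => L (usubmx z) w) (dsubmx z)).

Definition Jmx : mat := block_mx 1%:M 0 0 (- 1%:M).

Definition J_symmetric (M : mat) : Prop := M = Jmx *m M^T *m Jmx.

Definition model (Fz g : V) (B : mat) (s : V) : R :=
  enorm Fz ^+ 2 / 2 + dotv g s + dotv s (B^T *m B *m s) / 2.

Definition step_B (g : V) (B : mat) : V := - (invmx B *m (invmx B)^T *m g).

Definition step_C (g : V) (B : mat) (Delta : R) : V :=
  - (Num.min (enorm g ^+ 2 / dotv g (B^T *m B *m g)) (Delta / enorm g) *: g).

(* alpha is unique: the norm is convex along the segment from pC to pB, below
   Delta at pC and above it at pB.  If g = 0 then pB = 0 and s = 0; so
   along a run with all s_k nonzero (and B_k nonsingular) no denominator in
   [step_C], [reduction_ratio] or [B_update] vanishes. *)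
Definition dogleg_step (g : V) (B : mat) (Delta : R) (s : V) : Prop :=
  let pB := step_B g B in
  let pC := step_C g B Delta in
  [/\ enorm pB <= Delta -> s = pB,
      Delta < enorm pB -> enorm pC = Delta -> s = pC
    & Delta < enorm pB -> enorm pC < Delta ->
      exists alpha : R,
        [/\ 0 < alpha < 1, enorm (pC + alpha *: (pB - pC)) = Delta
          & s = pC + alpha *: (pB - pC)]].

Definition reduction_ratio (F : V -> V) (g : V) (B : mat) (z s : V) : R :=
  (enorm (F z) ^+ 2 / 2 - enorm (F (z + s)) ^+ 2 / 2) /
  (model (F z) g B 0 - model (F z) g B s).

Definition B_update (B : mat) (beta : R) (s y : V) : mat :=
  let r := y - B *m s in
  B + (beta / dotv s s) *: (Jmx *m s *m r^T *m Jmx + r *m s^T)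
    - (beta ^+ 2 * dotv (Jmx *m s) r / dotv s s ^+ 2) *: (Jmx *m s *m s^T).

Definition beta_hat : R := 9 / 10.

(* One realization of the algorithm: [beta] is the sequence of drawn
   relaxation parameters and every B_k is nonsingular. *)
Record algorithm_run (F : V -> V) (z0 : V) (B0 : mat) (R0 Delta0 zeta : R)
    (z s : nat -> V) (B : nat -> mat) (Delta beta : nat -> R) : Prop := {
  run_zeta : 0 < zeta < 10 ^- 3;
  run_R0 : 0 < R0;
  run_Delta0 : 0 < Delta0 <= R0;
  run_B0_unit : B0 \in unitmx;
  run_B0_Jsym : J_symmetric B0;
  run_init : [/\ z 0%N = z0, B 0%N = B0 & Delta 0%N = Delta0];
  run_B_unit : forall k, B k \in unitmx;
  run_beta : forall k, 1 - beta_hat <= beta k <= 1 + beta_hat;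
  run_step : forall k,
    let g := (jac F (z k))^T *m F (z k) in
    let rho := reduction_ratio F g (B k) (z k) (s k) in
    [/\ dogleg_step g (B k) (Delta k) (s k),
        Delta k.+1 = (if rho <= 1 / 2 then Delta k / 2
                      else Num.min (2 * Delta k) R0),
        z k.+1 = (if zeta <= rho then z k + s k else z k)
      & B k.+1 = B_update (B k) (beta k) (s k) (F (z k + s k) - F (z k))]
}.

End Algorithm.

(* Main.v *)
Require Import Defs.
From HB Require Import structures.
From mathcomp Require Import all_boot all_order all_algebra.
From mathcomp Require Import all_classical all_reals all_analysis.
From mathcomp Require Import ring lra.
Import Order.TTheory GRing.Theory Num.Theory.
Import numFieldNormedType.Exports.
Local Open Scope classical_set_scope.
Local Open Scope ring_scope.

(** Write A for the Jacobian of F = [minimaxF L] at the limit z*, and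
    H_k = J (B_k - A).

    Convergence of B_k.  Since F is J times a gradient, J A is a Hessian, hence
    symmetric by Schwarz's theorem, and the update preserves the symmetry of
    J B_k; so every H_k is symmetric.  If y_k were exactly A s_k, the update
    would read H_{k+1} = D_k H_k D_k^T, where D_k = 1 - beta_k u_k u_k^T
    multiplies the direction u_k = s_k / |s_k| by 1 - beta_k, which lies in
    [-9/10, 9/10] ([B_update_psb], [psb_residual]).  The product of the D_k over
    a window of uniformly independent directions is a strict contraction with
    a uniform constant ([damping_window_contracts]).  As F is continuously
    differentiable, z_k tends to z* and s_k tends to 0, strict
    differentiability gives y_k = A s_k + o(|s_k|)
    ([C1map_linearization]); the true recursion is thus the exact one up to
    errors tending to 0, and H_k tends to 0 ([jsym_updates_converge]).

    Superlinear convergence.  Put e_k = z_k - z*.  Now B_k and the Jacobian at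
    z_k both tend to the invertible A, and F(z_k) = A e_k + o(|e_k|); hence the
    full step p_k = - B_k^-1 B_k^-T g_k satisfies p_k = - e_k + o(|e_k|)
    ([newton_error]).  Every dogleg step predicts a decrease of at least a
    constant times |g_k| |s_k|, with |s_k| at most a constant times |g_k|
    ([dogleg_decrease]), while the model error is o(|g_k| |s_k|); so the ratios
    rho_k are eventually above 3 / 5 ([ratio_close]).  From then on every step
    is accepted and the radius never decreases.  The radii staying away from 0
    and p_k tending to 0, eventually s_k = p_k, and e_{k+1} = o(|e_k|)
    ([run_Q_superlinear]).  This implies the convergence of the k-th roots to 0
    ([Q_superlinear_root_cvg0]).  *)

Set Implicit Arguments.
Unset Strict Implicit.
Unset Printing Implicit Defensive.

(** * The Frobenius norm *)

Section FrobeniusNorm.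
Context {R : realType}.

(** The Frobenius inner product and norm.  A vector is a one-column matrix, so
    a single submultiplicative norm serves vectors and matrices alike; on
    vectors it is the Euclidean norm, and it dominates the operator norm. *)
Definition dotm {p q : nat} (A B : 'M[R]_(p, q)) : R := \tr (A^T *m B).

Definition fnorm {p q : nat} (A : 'M[R]_(p, q)) : R := Num.sqrt (dotm A A).

Lemma dotmE p q (A B : 'M[R]_(p, q)) : dotm A B = \sum_j \sum_i A i j * B i j.
Proof.
by apply: eq_bigr => j _; rewrite mxE; apply: eq_bigr => i _; rewrite mxE.
Qed.

Lemma dotvE N (u v : 'cV[R]_N) : dotv u v = dotm u v.
Proof. by rewrite dotmE big_ord1. Qed.

Lemma enormE N (u : 'cV[R]_N) : enorm u = fnorm u.
Proof. by rewrite /enorm dotvE. Qed.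

Lemma dotmC p q (A B : 'M[R]_(p, q)) : dotm A B = dotm B A.
Proof. by rewrite /dotm -mxtrace_tr trmx_mul trmxK. Qed.

Lemma dotmDl p q (A B C : 'M[R]_(p, q)) : dotm (A + B) C = dotm A C + dotm B C.
Proof. by rewrite /dotm linearD /= mulmxDl mxtraceD. Qed.

Lemma dotmDr p q (A B C : 'M[R]_(p, q)) : dotm A (B + C) = dotm A B + dotm A C.
Proof. by rewrite /dotm mulmxDr mxtraceD. Qed.

Lemma dotmZl p q a (A B : 'M[R]_(p, q)) : dotm (a *: A) B = a * dotm A B.
Proof. by rewrite /dotm linearZ /= -scalemxAl mxtraceZ. Qed.

Lemma dotmZr p q a (A B : 'M[R]_(p, q)) : dotm A (a *: B) = a * dotm A B.
Proof. by rewrite /dotm -scalemxAr mxtraceZ. Qed.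

Lemma dotmNl p q (A B : 'M[R]_(p, q)) : dotm (- A) B = - dotm A B.
Proof. by rewrite -scaleN1r dotmZl mulN1r. Qed.

Lemma dotmNr p q (A B : 'M[R]_(p, q)) : dotm A (- B) = - dotm A B.
Proof. by rewrite -scaleN1r dotmZr mulN1r. Qed.

Lemma dotmBl p q (A B C : 'M[R]_(p, q)) : dotm (A - B) C = dotm A C - dotm B C.
Proof. by rewrite dotmDl dotmNl. Qed.

Lemma dotmBr p q (A B C : 'M[R]_(p, q)) : dotm A (B - C) = dotm A B - dotm A C.
Proof. by rewrite dotmDr dotmNr. Qed.

Lemma dotm_mul p q r (A : 'M[R]_(p, q)) (B : 'M[R]_(q, r)) C :
  dotm (A *m B) C = dotm B (A^T *m C).
Proof. by rewrite /dotm trmx_mul mulmxA. Qed.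

Lemma dotm_ge0 p q (A : 'M[R]_(p, q)) : 0 <= dotm A A.
Proof.
by rewrite dotmE; do 2!apply: sumr_ge0 => ? _; rewrite -expr2 sqr_ge0.
Qed.

Lemma sqr_fnorm p q (A : 'M[R]_(p, q)) : fnorm A ^+ 2 = dotm A A.
Proof. by rewrite sqr_sqrtr // dotm_ge0. Qed.

Lemma fnorm_ge0 p q (A : 'M[R]_(p, q)) : 0 <= fnorm A.
Proof. exact: sqrtr_ge0. Qed.

Lemma fnorm_eq0 p q (A : 'M[R]_(p, q)) : (fnorm A == 0) = (A == 0).
Proof.
apply/idP/eqP => [|->]; last by rewrite /fnorm /dotm mulmx0 mxtrace0 sqrtr0.
rewrite sqrtr_eq0 => A0; have /eqP : dotm A A = 0.
  by apply/eqP; rewrite eq_le A0 dotm_ge0.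
rewrite dotmE psumr_eq0 => [|j _]; last first.
  by apply: sumr_ge0 => i _; rewrite -expr2 sqr_ge0.
move=> /allP /= h; apply/matrixP => i j; rewrite mxE.
have := h j (mem_index_enum j); rewrite psumr_eq0 => [|k _]; last first.
  by rewrite -expr2 sqr_ge0.
by move=> /allP /(_ i (mem_index_enum i)) /=; rewrite mulf_eq0 orbb => /eqP.
Qed.

Lemma fnorm0 p q : fnorm (0 : 'M[R]_(p, q)) = 0.
Proof. by apply/eqP; rewrite fnorm_eq0. Qed.

Lemma fnorm_gt0 p q (A : 'M[R]_(p, q)) : (0 < fnorm A) = (A != 0).
Proof. by rewrite lt_neqAle eq_sym fnorm_eq0 fnorm_ge0 andbT. Qed.

Lemma fnormZ p q a (A : 'M[R]_(p, q)) : fnorm (a *: A) = `|a| * fnorm A.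
Proof. by rewrite /fnorm dotmZl dotmZr mulrA -expr2 sqrtrM ?sqr_ge0 // sqrtr_sqr. Qed.

Lemma fnormN p q (A : 'M[R]_(p, q)) : fnorm (- A) = fnorm A.
Proof. by rewrite -scaleN1r fnormZ normrN1 mul1r. Qed.

Lemma fnormT p q (A : 'M[R]_(p, q)) : fnorm A^T = fnorm A.
Proof. by rewrite /fnorm /dotm trmxK mxtrace_mulC. Qed.

(** Cauchy-Schwarz: expand 0 <= |<B,B> A - <A,B> B|^2. *)
Lemma norm_dotm_le p q (A B : 'M[R]_(p, q)) :
  `|dotm A B| <= fnorm A * fnorm B.
Proof.
rewrite -ler_sqr ?nnegrE ?mulr_ge0 ?fnorm_ge0 // exprMn real_normK ?num_real //.
rewrite !sqr_fnorm; have [->|B0] := eqVneq B 0.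
  by rewrite /dotm !mulmx0 mxtrace0 mulr0 expr0n.
have Bgt0 : 0 < dotm B B by rewrite -sqr_fnorm exprn_gt0 // fnorm_gt0.
have := dotm_ge0 (dotm B B *: A - dotm A B *: B).
rewrite !(dotmDl, dotmDr, dotmNl, dotmNr, dotmZl, dotmZr) (dotmC B A).
set a := dotm A A; set b := dotm B B; set c := dotm A B => h.
have {}h : 0 <= b * (a * b - c ^+ 2) by apply: le_trans h _; lra.
by rewrite pmulr_rge0 // subr_ge0 in h.
Qed.

Lemma ler_dotm p q (A B : 'M[R]_(p, q)) : dotm A B <= fnorm A * fnorm B.
Proof. exact: le_trans (ler_norm _) (norm_dotm_le _ _). Qed.

Lemma ler_fnormD p q (A B : 'M[R]_(p, q)) : fnorm (A + B) <= fnorm A + fnorm B.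
Proof.
rewrite -ler_sqr ?nnegrE ?addr_ge0 ?fnorm_ge0 // sqrrD !sqr_fnorm.
rewrite dotmDl !dotmDr (dotmC B A).
have := ler_dotm A B; lra.
Qed.

Lemma ler_fnormB p q (A B : 'M[R]_(p, q)) : fnorm (A - B) <= fnorm A + fnorm B.
Proof. by rewrite -(fnormN B) ler_fnormD. Qed.

(** Lets a bound on the action of a matrix on vectors pass to its action on
    matrices, column by column. *)
Lemma sqr_fnorm_col p q (A : 'M[R]_(p, q)) :
  fnorm A ^+ 2 = \sum_j fnorm (col j A) ^+ 2.
Proof.
rewrite sqr_fnorm dotmE; apply: eq_bigr => j _.
rewrite sqr_fnorm dotmE big_ord1; apply: eq_bigr => i _; by rewrite mxE.
Qed.

Lemma ler_fnormM p q r (A : 'M[R]_(p, q)) (B : 'M[R]_(q, r)) :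
  fnorm (A *m B) <= fnorm A * fnorm B.
Proof.
rewrite -ler_sqr ?nnegrE ?mulr_ge0 ?fnorm_ge0 // exprMn.
rewrite (sqr_fnorm_col B) -(fnormT A) (sqr_fnorm_col A^T) mulr_sumr.
rewrite sqr_fnorm dotmE; apply: ler_sum => j _.
rewrite mulr_suml; apply: ler_sum => i _; rewrite -expr2 -exprMn.
have -> : (A *m B) i j = dotm (col i A^T) (col j B).
  by rewrite dotmE big_ord1 mxE; apply: eq_bigr => k _; rewrite !mxE.
by rewrite -(real_normK (num_real (dotm _ _))) ler_sqr ?nnegrE ?mulr_ge0 ?fnorm_ge0 // norm_dotm_le.
Qed.

Lemma norm_coef_fnorm p q (A : 'M[R]_(p, q)) i j : `|A i j| <= fnorm A.
Proof.
rewrite -ler_sqr ?nnegrE ?fnorm_ge0 // real_normK ?num_real // sqr_fnorm dotmE.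
rewrite (bigD1 j) //= (bigD1 i) //= -expr2 -addrA lerDl addr_ge0 //.
  by apply: sumr_ge0 => k _; rewrite -expr2 sqr_ge0.
by do 2!apply: sumr_ge0 => ? _; rewrite -expr2 sqr_ge0.
Qed.

Lemma norm_coef_le p q (A : 'M[R]_(p, q)) i j : `|A i j| <= `|A|.
Proof.
by rewrite [leRHS]/Num.norm /= mx_normrE; apply/bigmax_geP; right; exists (i, j).
Qed.

Lemma fnorm_le_norm p q (A : 'M[R]_(p, q)) :
  fnorm A <= Num.sqrt (q * p)%:R * `|A|.
Proof.
rewrite -ler_sqr ?nnegrE ?mulr_ge0 ?fnorm_ge0 ?sqrtr_ge0 // exprMn.
rewrite sqr_fnorm dotmE sqr_sqrtr ?ler0n //.
apply: (@le_trans _ _ (\sum_(j < q) \sum_(i < p) `|A| ^+ 2)).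
  apply: ler_sum => j _; apply: ler_sum => i _.
  by rewrite -expr2 -real_normK ?num_real // ler_sqr ?nnegrE // norm_coef_le.
by rewrite !sumr_const !card_ord -mulrnA mulr_natl (mulnC p q) lexx.
Qed.

Lemma norm_le_fnorm p q (A : 'M[R]_(p, q)) : `|A| <= fnorm A.
Proof.
rewrite [leLHS]/Num.norm /= mx_normrE; apply/bigmax_leP; split => [|i _].
  exact: fnorm_ge0.
exact: norm_coef_fnorm.
Qed.

(** The library topology is that of the max norm, which is equivalent to the
    Frobenius norm; convergence is translated once and for all here. *)
Lemma cvg_fnorm p q (A : nat -> 'M[R]_(p, q)) (X : 'M[R]_(p, q)) :
  (A k @[k --> \oo] --> X) <->
  (forall e, 0 < e -> \forall k \near \oo, fnorm (A k - X) <= e).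
Proof.
split=> [/cvgrPdistC_le h e e0|h].
  have c0 : 0 < Num.sqrt (q * p)%:R + 1 :> R.
    by rewrite ltr_wpDl // sqrtr_ge0.
  have := h _ (divr_gt0 e0 c0); apply: filterS => k hk.
  apply: le_trans (fnorm_le_norm _) _.
  move: hk; rewrite ler_pdivlMr // => hk; apply: le_trans hk.
  by rewrite mulrC ler_wpM2l // lerDl.
apply/cvgrPdistC_le => e e0; have := h _ e0; apply: filterS => k hk.
exact: le_trans (norm_le_fnorm _) hk.
Qed.

End FrobeniusNorm.

(** * Second derivatives and strict differentiability *)

Section Calculus.
Context {R : realType}.

Lemma mean_value_along (V : normedModType R) (f : V -> R) (a v : V) :
  (forall z, differentiable f z) ->
  exists2 c, 0 <= c <= 1 & f (a + v) - f a = 'D_v f (a + c *: v).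
Proof.
move=> df; pose phi (t : R) := f (a + t *: v).
have dphi (t : R) : is_derive t 1 phi ('D_v f (a + t *: v)).
  have E : (fun h : R => h^-1 *: ((phi \o shift t) (h *: 1) - phi t)) =
           (fun h : R => h^-1 *: ((f \o shift (a + t *: v)) (h *: v) - f (a + t *: v))).
    apply/funext => h; rewrite /phi /= -[h *: 1]/(h * 1) mulr1 scalerDl.
    by rewrite addrCA.
  by split; rewrite /derivable /derive E //; exact: diff_derivable.
have cphi : {within `[0, 1], continuous phi}.
  apply: continuous_subspaceT => t.
  by apply/differentiable_continuous/derivable1_diffP.
have [c c01] := MVT_segment ler01 (fun t _ => dphi t) cphi.
rewrite /phi scale1r scale0r addr0 subr0 mulr1 => E.
by exists c => //; move: c01; rewrite in_itv.
Qed.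

Lemma derive_scale_at (V : normedModType R) (f : V -> R) (h : R) (v z : V) :
  differentiable f z -> 'D_(h *: v) f z = h * 'D_v f z.
Proof. by move=> df; rewrite !deriveE // linearZ. Qed.

Lemma derive_scale (V : normedModType R) (f : V -> R) (h : R) (v : V) :
  (forall z, differentiable f z) -> 'D_(h *: v) f = h *: 'D_v f :> (V -> R).
Proof. by move=> df; apply/funext => z; exact: derive_scale_at. Qed.

Lemma derive_translate (V : normedModType R) (f : V -> R) (b v z : V) :
  'D_v (fun x => f (x + b)) z = 'D_v f (z + b).
Proof. by rewrite /derive /=; under eq_fun do rewrite -addrA. Qed.

(** Two mean value steps, first along u, then along v.  The left-hand side is
    symmetric in u and v, which is what makes the mixed derivatives agree. *)
Lemma second_difference (V : normedModType R) (f : V -> R) (a u v : V) :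
  (forall z, differentiable f z) -> (forall z, differentiable ('D_u f) z) ->
  exists c d, [/\ 0 <= c <= 1, 0 <= d <= 1 &
    f (a + u + v) - f (a + u) - (f (a + v) - f a) =
    'D_v ('D_u f) (a + c *: u + d *: v)].
Proof.
move=> df ddf.
have dfv z : differentiable (fun x => f (x + v)) z.
  by apply: differentiable_comp.
have [c c01] := @mean_value_along _ (fun x => f (x + v) - f x) a u
  (fun z => differentiableB (dfv z) (df z)).
rewrite deriveB; [|exact: diff_derivable..].
rewrite derive_translate => ->.
have [d d01 ->] := mean_value_along (a + c *: u) v ddf.
by exists c, d.
Qed.

(** Schwarz's theorem.  Both mixed derivatives, taken at two points within a
    multiple of h of a, are equal to the same second difference divided by
    h ^ 2; continuity at a finishes. *)
Lemma second_derivative_symmetric (V : normedModType R) (f : V -> R) (a u v : V) :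
  (forall z, differentiable f z) -> (forall z, differentiable ('D_u f) z) ->
  (forall z, differentiable ('D_v f) z) ->
  {for a, continuous ('D_v ('D_u f))} -> {for a, continuous ('D_u ('D_v f))} ->
  'D_v ('D_u f) a = 'D_u ('D_v f) a.
Proof.
move=> df duf dvf cvu cuv; apply/eqP; rewrite -subr_eq0 -normr_le0.
apply/ler_addgt0Pr => e e0; rewrite add0r.
have e20 : 0 < e / 2 by rewrite divr_gt0.
move/cvgrPdist_le : cvu => /(_ _ e20) /nbhs_ballP [d1 /= d10 h1].
move/cvgrPdist_le : cuv => /(_ _ e20) /nbhs_ballP [d2 /= d20 h2].
have d0 : 0 < Num.min d1 d2 by rewrite lt_min d10 d20.
have [h h0 hd] : exists2 h : R, 0 < h & h * (`|u| + `|v|) < Num.min d1 d2.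
  have D0 : 0 < `|u| + `|v| + 1 by rewrite ltr_wpDl // addr_ge0.
  exists (Num.min d1 d2 / (`|u| + `|v| + 1)); first by rewrite divr_gt0.
  by rewrite mulrAC ltr_pdivrMr // ltr_pM2l // ltrDl.
have near_a (c d : R) (w w' : V) : 0 <= c <= 1 -> 0 <= d <= 1 ->
    `|w| + `|w'| = `|u| + `|v| ->
    `|a - (a + c *: (h *: w) + d *: (h *: w'))| < Num.min d1 d2.
  move=> /andP[c0 c1] /andP[d'0 d'1] ww.
  rewrite -addrA opprD addrA subrr add0r normrN.
  apply: le_lt_trans (ler_normD _ _) _; rewrite !normrZ.
  rewrite (ger0_norm c0) (ger0_norm d'0) (gtr0_norm h0).
  apply: (@le_lt_trans _ _ (h * (`|w| + `|w'|))).
    by rewrite mulrDr lerD // ler_piMl // mulr_ge0 // ltW.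
  by rewrite ww.
have scaled w : (forall z, differentiable ('D_w f) z) ->
    forall z, differentiable ('D_(h *: w) f) z.
  by move=> dw z; rewrite derive_scale //; exact: differentiableZ.
have [c [d [c01 d01 E1]]] := second_difference a (h *: v) df (scaled _ duf).
have [c' [d' [c01' d01' E2]]] := second_difference a (h *: u) df (scaled _ dvf).
have scale2 w w' p : (forall z, differentiable ('D_w f) z) ->
    'D_(h *: w') ('D_(h *: w) f) p = h * h * 'D_w' ('D_w f) p.
  move=> dw; rewrite derive_scale // derive_scale_at; last exact: differentiableZ.
  by rewrite deriveZ ?mulrA //; exact: diff_derivable.
rewrite scale2 // in E1; rewrite scale2 // in E2.
set p := a + c *: _ + _ in E1; set q := a + c' *: _ + _ in E2.
have eqpq : 'D_v ('D_u f) p = 'D_u ('D_v f) q.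
  have hh : h * h != 0 by rewrite mulf_neq0 // gt_eqF.
  have swap (x y x' y' : R) : x - y - (x' - y') = x - x' - (y - y') by ring.
  apply: (mulfI hh); apply: etrans (esym E1) _; apply: etrans E2.
  by rewrite (addrAC a (h *: v)); exact: swap.
have hp := near_a c d u v c01 d01 erefl.
have hq := near_a c' d' v u c01' d01' (addrC _ _).
have {}hp : `|'D_v ('D_u f) a - 'D_v ('D_u f) p| <= e / 2.
  by apply: h1; rewrite -ball_normE; apply: lt_le_trans hp _; rewrite ge_min lexx.
have {}hq : `|'D_u ('D_v f) a - 'D_u ('D_v f) q| <= e / 2.
  by apply: h2; rewrite -ball_normE; apply: lt_le_trans hq _; rewrite ge_min lexx orbT.
rewrite eqpq in hp; rewrite distrC in hq.
rewrite (splitr e); apply: le_trans (ler_distD ('D_u ('D_v f) q) _ _) _.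
exact: lerD hp hq.
Qed.

Lemma derive_linear_combination (N : nat) (V : normedModType R) (c : 'I_N -> R)
  (f : 'I_N -> V -> R) (z v : V) : (forall k, differentiable (f k) z) ->
  'D_v (fun x => \sum_k c k * f k x) z = \sum_k c k * 'D_v (f k) z.
Proof.
move=> df.
have -> : (fun x => \sum_k c k * f k x) = \sum_k (c k *: f k).
  by apply/funext => x; rewrite fct_sumE.
rewrite derive_sum => [|k]; last exact/derivableZ/diff_derivable.
by apply: eq_bigr => k _; rewrite deriveZ //; exact: diff_derivable.
Qed.

Lemma differentiable_linear_combination (N : nat) (V : normedModType R) (c : 'I_N -> R)
  (f : 'I_N -> V -> R) (z : V) : (forall k, differentiable (f k) z) ->
  differentiable (fun x => \sum_k c k * f k x) z.
Proof.
move=> df.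
have -> : (fun x => \sum_k c k * f k x) = \sum_k (c k *: f k).
  by apply/funext => x; rewrite fct_sumE.
by apply: differentiable_sum => k; exact: differentiableZ.
Qed.

Lemma derive_coordinates (N : nat) (f : 'cV[R]_N -> R) (v z : 'cV[R]_N) :
  differentiable f z ->
  'D_v f z = \sum_j v j 0 * 'D_(delta_mx j 0) f z.
Proof.
move=> df; rewrite deriveE // {1}(matrix_sum_delta v) linear_sum.
by apply: eq_bigr => j _; rewrite big_ord1 linearZ deriveE.

Qed.

Lemma continuous_trmx (p q : nat) : continuous (@trmx R p q).
Proof.
move=> A; apply/(@cvgrPdist_le _ _ _ (nbhs A) (nbhs_filter A)) => e e0.
apply/nbhs_ballP; exists e => //= B.
rewrite mx_norm_ball /ball_ => /ltW h; apply: le_trans h.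
rewrite [leLHS]/Num.norm /= mx_normrE; apply/bigmax_leP; split => // -[i j] _.
have := norm_coef_le (A - B) j i; by rewrite !mxE.
Qed.

Lemma differentiable_cV (N M : nat) (G : 'cV[R]_N -> 'cV[R]_M) (z : 'cV[R]_N) :
  (forall i, differentiable (fun x => G x i 0) z) -> differentiable G z.
Proof.
move=> dG.
have -> : G = \sum_i (fun x => G x i 0 *: delta_mx i 0).
  apply/funext => x; rewrite fct_sumE {1}[G x]matrix_sum_delta.
  by apply: eq_bigr => i _; rewrite big_ord1.
by apply: differentiable_sum => i; exact: differentiableZl.
Qed.

(** Transposing an argument does not change a directional derivative, so the
    detour of [jac] through row vectors is invisible on the entries. *)
Lemma jac_coef (N : nat) (G : 'cV[R]_N -> 'cV[R]_N) (z : 'cV[R]_N) i j :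
  (forall i, differentiable (fun x => G x i 0) z) ->
  jac G z i j = 'D_(delta_mx j 0) (fun x => G x i 0) z.
Proof.
move=> dG; have dT p q A : differentiable (@trmx R p q) A.
  by apply: linear_differentiable; exact: continuous_trmx.
have dGT : differentiable (fun u : 'rV[R]_N => (G u^T)^T) z^T.
  apply: (differentiable_comp (f := fun u => G u^T) (g := @trmx R N 1)) => //.
  apply: (differentiable_comp (f := @trmx R 1 N) (g := G)) => //.
  by rewrite trmxK; exact: differentiable_cV.
rewrite /jac mxE /jacobian mxE -deriveE // derive_mx; last exact: diff_derivable.
rewrite mxE /derive /=; apply: (congr1 (fun f => lim (f @ 0^'))).
apply/funext => h /=.
have -> : (h *: delta_mx 0 j + z^T)^T = h *: delta_mx j 0 + z.
  by rewrite linearD linearZ /= trmxK trmx_delta.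
by rewrite !mxE trmxK.
Qed.

(** Strict differentiability, along sequences: the mean value theorem puts the
    increment at a point between z k and z k + s k, where the partial
    derivatives are already close to those at a. *)
Lemma strictly_differentiable (N : nat) (f : 'cV[R]_N -> R) (a : 'cV[R]_N)
  (z s : nat -> 'cV[R]_N) (e : R) :
  (forall x, differentiable f x) ->
  (forall j, {for a, continuous ('D_(delta_mx j 0) f)}) ->
  z k @[k --> \oo] --> a -> s k @[k --> \oo] --> (0 : 'cV[R]_N) -> 0 < e ->
  \forall k \near \oo,
    `|f (z k + s k) - f (z k) - 'D_(s k) f a| <= e * fnorm (s k).
Proof.
move=> df cf hz hs e0.
pose e' := e / (N%:R + 1).
have N0 : 0 < N%:R + 1 :> R by exact: ltr_wpDl (ler0n _ _) ltr01.
have e'0 : 0 < e' by rewrite divr_gt0.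
have Ne' : N%:R * e' <= e.
  rewrite /e' mulrCA ler_piMr ?(ltW e0) // ler_pdivrMr // mul1r.
  exact: ler_wpDr ler01 (lexx _).
have near_a : \forall x \near a,
    forall j, `|'D_(delta_mx j 0) f x - 'D_(delta_mx j 0) f a| <= e'.
  apply: (@filter_forall _ _ (fun j x =>
    `|'D_(delta_mx j 0) f x - 'D_(delta_mx j 0) f a| <= e') (nbhs a)) => j.
  exact: (cvgrPdistC_le _ _).1 (cf j) _ e'0.
move/nbhs_ballP : near_a => [d /= d0 hd].
have d20 : 0 < d / 2 by rewrite divr_gt0.
move/cvgrPdistC_le : hz => /(_ _ d20) hz.
move/cvgrPdistC_lt : hs => /(_ _ d20) hs.
move: hz hs; apply: filterS2 => k hzk hsk.
have [c /andP[c0 c1] ->] := mean_value_along (z k) (s k) df.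
rewrite derive_coordinates // (derive_coordinates (s k) (df a)) -sumrB.
have {}hd : forall j, `|'D_(delta_mx j 0) f (z k + c *: s k) - 'D_(delta_mx j 0) f a| <= e'.
  apply: hd; rewrite -ball_normE /ball_ /= distrC addrAC.
  apply: le_lt_trans (ler_normD _ _) _; rewrite (splitr d).
  apply: ler_ltD; first exact: hzk.
  rewrite normrZ ger0_norm //; apply: le_lt_trans (ler_piMl _ c1) _ => //.
  by rewrite -[s k]subr0.
apply: (@le_trans _ _ (\sum_(j < N) e' * fnorm (s k))).
  apply: le_trans (ler_norm_sum _ _ _) _; apply: ler_sum => j _.
  rewrite -mulrBr normrM mulrC.
  exact: ler_pM (normr_ge0 _) (normr_ge0 _) (hd j) (norm_coef_fnorm _ _ _).
rewrite sumr_const card_ord -mulr_natl mulrA.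
exact: (ler_wpM2r (fnorm_ge0 _) Ne').
Qed.

(** Asking for globally continuous partial derivatives of each coordinate is
    the form in which continuous differentiability is used: each coordinate
    has its own mean value point. *)
Definition C1map (N : nat) (G : 'cV[R]_N -> 'cV[R]_N) : Prop :=
  (forall i x, differentiable (fun x => G x i 0) x) /\
  (forall i j, continuous ('D_(delta_mx j 0) (fun x => G x i 0))).

Lemma C1map_linearization (N : nat) (G : 'cV[R]_N -> 'cV[R]_N) (a : 'cV[R]_N)
  (z s : nat -> 'cV[R]_N) (e : R) : C1map G ->
  z k @[k --> \oo] --> a -> s k @[k --> \oo] --> (0 : 'cV[R]_N) -> 0 < e ->
  \forall k \near \oo,
    fnorm (G (z k + s k) - G (z k) - jac G a *m s k) <= e * fnorm (s k).
Proof.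
move=> [dG cG] hz hs e0.
have C0 : 0 < Num.sqrt (1 * N)%:R + 1 :> R by rewrite ltr_wpDl // sqrtr_ge0.
pose e' := e / (Num.sqrt (1 * N)%:R + 1).
have e'0 : 0 < e' by rewrite divr_gt0.
have : \forall k \near \oo, forall i, `|G (z k + s k) i 0 - G (z k) i 0
    - 'D_(s k) (fun x => G x i 0) a| <= e' * fnorm (s k).
  apply: filter_forall => i; apply: strictly_differentiable => //.
  by move=> j; exact: cG.
apply: filterS => k hk; apply: le_trans (fnorm_le_norm _) _.
apply: (@le_trans _ _ (Num.sqrt (1 * N)%:R * (e' * fnorm (s k)))).
  rewrite ler_wpM2l ?sqrtr_ge0 // [leLHS]/Num.norm /= mx_normrE.
  apply/bigmax_leP; split=> [|[i j] _ /=]; first by rewrite mulr_ge0 ?fnorm_ge0 ?(ltW e'0).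
  rewrite (ord1 j) !mxE; apply: le_trans (hk i); rewrite derive_coordinates //.
  rewrite (eq_bigr (fun j => s k j 0 * 'D_(delta_mx j 0) (fun x => G x i 0) a)) //.
  by move=> l _; rewrite mulrC jac_coef.
rewrite mulrA ler_wpM2r ?fnorm_ge0 // /e' mulrCA ler_piMr ?(ltW e0) //.
by rewrite ler_pdivrMr // mul1r lerDl.
Qed.

Lemma norm_sub_le (p q : nat) (A B : 'M[R]_(p, q)) (e : R) : 0 <= e ->
  (forall i j, `|A i j - B i j| <= e) -> `|A - B| <= e.
Proof.
move=> e0 h; rewrite [leLHS]/Num.norm /= mx_normrE.
apply/bigmax_leP; split=> // -[i j] _; by have := h i j; rewrite !mxE.
Qed.

Lemma C1map_continuous_jac (N : nat) (G : 'cV[R]_N -> 'cV[R]_N) (a : 'cV[R]_N)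
  (z : nat -> 'cV[R]_N) : C1map G -> z k @[k --> \oo] --> a ->
  jac G (z k) @[k --> \oo] --> jac G a.
Proof.
move=> [dG cG] hz; apply/cvgrPdistC_le => e e0.
have : \forall k \near \oo, forall ij : 'I_N * 'I_N,
    `|jac G (z k) ij.1 ij.2 - jac G a ij.1 ij.2| <= e.
  apply: filter_forall => -[i j] /=.
  have hc : 'D_(delta_mx j 0) (fun x => G x i 0) (z k) @[k --> \oo] -->
      'D_(delta_mx j 0) (fun x => G x i 0) a.
    exact: cvg_comp hz (cG i j a).
  move/cvgrPdistC_le : hc => /(_ _ e0).
  have Ejac x := jac_coef i j (fun l => dG l x).
  apply: filterS => k hk.
  have -> : jac G (z k) i j - jac G a i j =
      'D_(delta_mx j 0) (fun x => G x i 0) (z k) -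
      'D_(delta_mx j 0) (fun x => G x i 0) a by congr (_ - _); exact: Ejac.
  exact: hk.
apply: filterS => k hk; apply: norm_sub_le (ltW e0) _ => i j.
exact: (hk (i, j)).
Qed.

End Calculus.

(** * The minimax field and its Jacobian *)

Section Minimax.
Context {R : realType} {n m : nat}.
Local Notation V := 'cV[R]_(n + m).
Local Notation J := (@Jmx R n m).

Lemma trmx_Jmx : J^T = J.
Proof. by rewrite /Jmx tr_block_mx !trmx0 trmx1 linearN /= trmx1. Qed.

Lemma mul_Jmx_Jmx : J *m J = 1%:M.
Proof.
rewrite /Jmx mulmx_block !mul0mx !mulmx0 !mulmxN !mulNmx !mul1mx !opprK.
by rewrite !addr0 !add0r -scalar_mx_block.
Qed.

(** The sign change in the second block of [minimaxF] is multiplication by J,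
    so the Jacobian of [minimaxF] is J times a Hessian. *)
Lemma minimaxF_grad (L : 'cV[R]_n -> 'cV[R]_m -> R) (z : V) :
  minimaxF L z = J *m grad (uncurryL L) z.
Proof.
rewrite /minimaxF -[grad (uncurryL L) z]vsubmxK /Jmx mul_block_col.
rewrite !mul0mx !mulNmx !mul1mx addr0 add0r; congr (col_mx _ (- _)).
  apply/colP => i; rewrite !mxE /derive.
  apply: (congr1 (fun f => lim (f @ 0^'))); apply/funext => h /=.
  have -> : h *: delta_mx (lshift m i) 0 + z =
      col_mx (h *: delta_mx i 0 + usubmx z) (dsubmx z).
    rewrite -{1}[z]vsubmxK -[dsubmx z in RHS]add0r -add_col_mx.
    congr (_ + _); apply/colP => j; rewrite !mxE.
    by case: splitP => k jk; rewrite !mxE -val_eqE /= jk // [_ == _]gtn_eqF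
      ?mulr0 // ltn_addr.
  by rewrite /uncurryL col_mxKu col_mxKd.
apply/colP => i; rewrite !mxE /derive.
apply: (congr1 (fun f => lim (f @ 0^'))); apply/funext => h /=.
have -> : h *: delta_mx (rshift n i) 0 + z =
    col_mx (usubmx z) (h *: delta_mx i 0 + dsubmx z).
  rewrite -{1}[z]vsubmxK -[usubmx z in RHS]add0r -add_col_mx.
  congr (_ + _); apply/colP => j; rewrite !mxE.
  case: splitP => k jk; rewrite !mxE -val_eqE /= jk.
    by rewrite ltn_eqF ?mulr0 // ltn_addr.
  by rewrite eqn_add2l.
by rewrite /uncurryL col_mxKu col_mxKd.
Qed.

Section C3.
Context {L : 'cV[R]_n -> 'cV[R]_m -> R}.
Hypothesis hL : times_differentiable 3 (uncurryL L).

Local Notation f := (uncurryL L).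
Local Notation F := (minimaxF L).
Local Notation pd i := ('D_(delta_mx i 0) f).

Let df z : differentiable f z. Proof. exact: hL.1. Qed.
Let ddf v z : differentiable ('D_v f) z. Proof. exact: (hL.2 v).1. Qed.
Let cddf v w : continuous ('D_w ('D_v f)).
Proof. by move=> z; apply: differentiable_continuous; exact: ((hL.2 v).2 w).1. Qed.

Lemma minimaxF_coef i : (fun z => F z i 0) = (fun z => \sum_k J i k * pd k z).
Proof.
apply/funext => z; rewrite minimaxF_grad mxE.
by apply: eq_bigr => k _; congr (_ * _); rewrite mxE.
Qed.

Lemma C1map_minimaxF : C1map F.
Proof.
split=> [i x|i j]; rewrite minimaxF_coef; first exact: differentiable_linear_combination.
have -> : 'D_(delta_mx j 0) (fun x => \sum_k J i k * pd k x) =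
    (fun x => \sum_k J i k * 'D_(delta_mx j 0) (pd k) x).
  by apply/funext => x; exact: derive_linear_combination.
move=> x; apply: differentiable_continuous; apply: differentiable_linear_combination => k.
exact: ((hL.2 _).2 _).1.
Qed.

Lemma jac_minimaxF z :
  J *m jac F z = \matrix_(i, j) 'D_(delta_mx j 0) (pd i) z.
Proof.
have -> : jac F z = J *m \matrix_(i, j) 'D_(delta_mx j 0) (pd i) z.
  apply/matrixP => i j; rewrite jac_coef => [|k]; last exact: C1map_minimaxF.1.
  rewrite minimaxF_coef derive_linear_combination // mxE.
  by apply: eq_bigr => k _; congr (_ * _); rewrite mxE.
by rewrite mulmxA mul_Jmx_Jmx mul1mx.
Qed.

(** The J-symmetry of the Jacobian, which is the symmetry of the Hessian. *)
Lemma jac_minimaxF_sym z : (J *m jac F z)^T = J *m jac F z.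
Proof.
rewrite jac_minimaxF; apply/matrixP => i j; rewrite !mxE.
by apply: second_derivative_symmetric => //; exact: cddf.
Qed.

End C3.
End Minimax.

(** * Products of relaxed projections *)

Section RelaxedUpdates.
Context {R : realType} {N : nat}.
Local Notation V := 'cV[R]_N.
Local Notation mat := 'M[R]_N.

(** For b = 1 this is the orthogonal projection killing s; for 0 < b < 2 it
    shrinks the component along s by the factor |1 - b| < 1 and leaves the
    orthogonal complement fixed. *)
Definition damping (b : R) (s : V) : mat :=
  1%:M - (b / dotm s s) *: (s *m s^T).

Lemma mul_col_row_col (s u v : V) : s *m u^T *m v = dotm u v *: s.
Proof.
by rewrite -mulmxA [u^T *m v]mx11_scalar mul_mx_scalar dotmE big_ord1 mxE;
  under eq_bigr do rewrite mxE.
Qed.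

Lemma damping_mul b s x :
  damping b s *m x = x - (b / dotm s s * dotm s x) *: s.
Proof.
by rewrite mulmxBl mul1mx -scalemxAl mul_col_row_col scalerA.
Qed.

Lemma trmx_damping b s : (damping b s)^T = damping b s.
Proof. by rewrite linearB /= trmx1 linearZ /= trmx_mul trmxK. Qed.

Lemma sqr_fnorm_damping b (s x : V) : s != 0 ->
  fnorm (damping b s *m x) ^+ 2 =
  fnorm x ^+ 2 - b * (2 - b) * dotm x ((fnorm s)^-1 *: s) ^+ 2.
Proof.
move=> s0; have n0 : fnorm s != 0 by rewrite fnorm_eq0.
rewrite damping_mul !sqr_fnorm dotmBl !dotmBr !dotmZl !dotmZr (dotmC s x).
by rewrite -!sqr_fnorm; field.
Qed.

(** The gain b (2 - b) = 1 - (1 - b)^2 is smallest at the two ends, where it is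
    19 / 100. *)
Lemma damping_gain (b : R) : 1 / 10 <= b <= 19 / 10 -> 19 / 100 <= b * (2 - b).
Proof. by move=> /andP[b1 b2]; nra. Qed.

Lemma ler_damping (b : R) (s : V) p (X : 'M[R]_(N, p)) :
  s != 0 -> 1 / 10 <= b <= 19 / 10 -> fnorm (damping b s *m X) <= fnorm X.
Proof.
move=> s0 /damping_gain hb.
rewrite -ler_sqr ?nnegrE ?fnorm_ge0 // !(sqr_fnorm_col (_ *m _)) (sqr_fnorm_col X).
apply: ler_sum => j _; rewrite colE -mulmxA -colE sqr_fnorm_damping //.
by rewrite lerBlDr lerDl mulr_ge0 ?sqr_ge0 //; lra.
Qed.

Lemma damping_dist (b : R) (s x : V) : s != 0 -> 0 <= b ->
  fnorm (damping b s *m x - x) = b * `|dotm x ((fnorm s)^-1 *: s)|.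
Proof.
move=> s0 b0; have n0 : 0 < fnorm s by rewrite fnorm_gt0.
rewrite damping_mul addrAC subrr add0r fnormN fnormZ dotmZr (dotmC x s).
rewrite -sqr_fnorm !normrM !normfV normrX (ger0_norm b0) (gtr0_norm n0).
by field; exact: lt0r_neq0.
Qed.

Fixpoint damping_window (b : nat -> R) (s : nat -> V) (k t : nat) : mat :=
  if t is t'.+1 then damping (b (k + t')%N) (s (k + t')%N) *m damping_window b s k t'
  else 1%:M.

Section Window.
Context {b : nat -> R} {s : nat -> V}.
Hypothesis hb : forall k, 1 / 10 <= b k <= 19 / 10.
Hypothesis hs : forall k, s k != 0.
Local Notation Q := (damping_window b s).

(** If no damping direction in a window sees much of the moving vector, then
    that vector hardly moves, so no direction sees much of the initial vector
    either; this contradicts the uniform independence of the directions.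
    Quantitatively, with e i the component of the i-th iterate along the i-th
    direction, the squared norm drops by at least 0.19 (e i)^2 at step i while
    the iterate moves by at most 2 (e i). *)
Lemma damping_window_contracts (k t : nat) (d : R) :
  (0 < t)%N -> 0 < d ->
  (forall x : V, fnorm x = 1 ->
    exists2 i, (i < t)%N & d <= `|dotm x ((fnorm (s (k + i)%N))^-1 *: s (k + i)%N)|) ->
  forall x : V, fnorm (Q k t *m x) ^+ 2 <= (1 - 19 / 1600 * d ^+ 2 / t%:R) * fnorm x ^+ 2.
Proof.
move=> t0 d0 hd x.
have [->|x0] := eqVneq x 0; first by rewrite mulmx0 fnorm0 expr0n mulr0.
wlog x1 : x x0 / fnorm x = 1.
  move=> /(_ ((fnorm x)^-1 *: x)); rewrite -!scalemxAr !fnormZ => h.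
  have n0 : 0 < fnorm x by rewrite fnorm_gt0.
  move: h; rewrite scaler_eq0 invr_eq0 fnorm_eq0 (negbTE x0) => /(_ isT).
  rewrite normfV gtr0_norm // mulVf ?gt_eqF // => /(_ erefl).
  by rewrite expr1n mulr1 exprMn exprVn ler_pdivrMl ?exprn_gt0 // mulrC.
pose e i := `|dotm (Q k i *m x) ((fnorm (s (k + i)%N))^-1 *: s (k + i)%N)|.
have eS i : Q k i.+1 *m x = damping (b (k + i)%N) (s (k + i)%N) *m (Q k i *m x).
  by rewrite mulmxA.
have decrease i :
    fnorm (Q k i *m x) ^+ 2 <= 1 - 19 / 100 * \sum_(j < i) e j ^+ 2.
  elim: i => [|i IH]; first by rewrite big_ord0 mulr0 subr0 mul1mx x1 expr1n.
  rewrite eS sqr_fnorm_damping // big_ord_recr /= [in leRHS]mulrDr opprD addrA.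
  apply: lerB => //; rewrite real_normK ?num_real // ler_wpM2r ?sqr_ge0 //.
  exact: damping_gain.
have drift i : fnorm (Q k i *m x - x) <= 2 * \sum_(j < i) e j.
  elim: i => [|i IH]; first by rewrite big_ord0 mulr0 mul1mx subrr fnorm0.
  rewrite -(subrK (Q k i *m x) (Q k i.+1 *m x)) -addrA big_ord_recr /= mulrDr.
  apply: le_trans (ler_fnormD _ _) _; rewrite [leRHS]addrC lerD // eS.
  have /andP[b0 b2] := hb (k + i)%N.
  rewrite damping_dist //; last by lra.
  by rewrite ler_wpM2r ?normr_ge0 //; lra.
have [i it hi] := hd x x1.
have total : d <= 4 * \sum_(j < t) e j.
  apply: le_trans hi _; set u := _ *: _.
  have u1 : fnorm u = 1.
    by rewrite fnormZ normfV gtr0_norm ?fnorm_gt0 // mulVf // fnorm_eq0.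
  have -> : dotm x u = dotm (Q k i *m x) u - dotm (Q k i *m x - x) u.
    by rewrite dotmBl opprB addrCA subrr addr0.
  have e0 j : 0 <= e j by exact: normr_ge0.
  have mono : \sum_(j < i.+1) e j <= \sum_(j < t) e j.
    rewrite -(big_mkord xpredT e) -(big_mkord xpredT e).
    rewrite (@big_cat_nat _ _ _ i.+1 0 t) //= lerDl.
    exact: sumr_ge0.
  apply: le_trans (ler_normB _ _) _.
  have := le_trans (norm_dotm_le (Q k i *m x - x) u) _.
  move=> /(_ _ (ler_wpM2r (fnorm_ge0 u) (drift i))); rewrite u1 mulr1.
  rewrite -/(e i) => h; move: mono; rewrite big_ord_recr /= => mono.
  have S0 : 0 <= \sum_(j < i) e j by exact: sumr_ge0.
  have := e0 i; lra.
have t0' : 0 < t%:R :> R by rewrite ltr0n.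
(* c is the common value of the e j that would just make total an equality;
   there the tangent bound e^2 >= 2 c e - c^2 loses nothing. *)
pose c := d / (4 * t%:R).
have c0 : 0 < c by rewrite divr_gt0 // mulr_gt0.
have squares : 2 * c * (\sum_(j < t) e j) - t%:R * c ^+ 2 <= \sum_(j < t) e j ^+ 2.
  have -> : t%:R * c ^+ 2 = \sum_(j < t) c ^+ 2.
    by rewrite sumr_const card_ord mulr_natl.
  rewrite mulr_sumr -sumrB.
  apply: ler_sum => j _; have := sqr_ge0 (e j - c); rewrite !expr2; lra.
apply: le_trans (decrease t) _; rewrite x1 expr1n mulr1 lerD2l lerN2.
have -> : 19 / 1600 * d ^+ 2 / t%:R = 19 / 100 * (c * (d / 2) - t%:R * c ^+ 2).
  by rewrite /c; field; rewrite gt_eqF.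
rewrite ler_wpM2l //; apply: le_trans squares; rewrite lerD2r -mulrA.
by have := ler_wpM2l (ltW c0) total; lra.
Qed.

Lemma conj_diff (D X Y P : mat) :
  D *m (D *m (X - P *m Y *m P^T)^T)^T =
  D *m X *m D^T - D *m P *m Y *m (D *m P)^T.
Proof.
by rewrite [(D *m _)^T]trmx_mul trmxK trmx_mul mulmxBl mulmxBr !mulmxA.
Qed.

(** Dampings never increase the norm, so the errors injected along a window
    add up without amplification. *)
Lemma window_recursion (H E : nat -> mat) (k t : nat) (e : R) :
  (forall j, H j.+1 =
     damping (b j) (s j) *m H j *m (damping (b j) (s j))^T + E j) ->
  (forall j, (k <= j)%N -> fnorm (E j) <= e) ->
  fnorm (H (k + t)%N - Q k t *m H k *m (Q k t)^T) <= t%:R * e.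
Proof.
move=> HS he; elim: t => [|t IH].
  by rewrite addn0 mul1mx trmx1 mulmx1 subrr fnorm0 mul0r.
rewrite addnS HS /=; set D := damping _ _.
have -> : D *m H (k + t)%N *m D^T + E (k + t)%N -
    D *m Q k t *m H k *m (D *m Q k t)^T =
    D *m (D *m (H (k + t)%N - Q k t *m H k *m (Q k t)^T)^T)^T + E (k + t)%N.
  by rewrite conj_diff addrAC.
apply: le_trans (ler_fnormD _ _) _; rewrite -natr1 mulrDl mul1r lerD //.
  apply: le_trans (ler_damping _ _ _) _ => //; rewrite fnormT.
  by apply: le_trans (ler_damping _ _ _) _ => //; rewrite fnormT.
by apply: he; rewrite leq_addr.
Qed.

End Window.

(** With d proportional to (1 - c) e, the recursion contracts the excess of
    [a] over e / 2 by the factor c every t steps. *)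
Lemma delayed_contraction_to0 (a : nat -> R) (c : R) (t : nat) :
  (forall k, 0 <= a k) -> 0 <= c < 1 -> (0 < t)%N ->
  (forall d, 0 < d -> \forall k \near \oo, a (k + t)%N <= c * a k + d) ->
  forall e, 0 < e -> \forall k \near \oo, a k <= e.
Proof.
move=> a0 /andP[c0 c1] t0 ha e e0.
have d0 : 0 < (1 - c) * (e / 2) by rewrite mulr_gt0 ?subr_gt0 ?divr_gt0.
have [K _ hK] := ha _ d0.
have {}hK k : (K + t <= k)%N -> a k <= c * a (k - t)%N + (1 - c) * (e / 2).
  move=> kK; have tk : (t <= k)%N by apply: leq_trans kK; rewrite leq_addl.
  by rewrite -{1}(subnK tk); apply: hK => /=; rewrite leq_subRL // addnC.
pose M := \sum_(i < K + t) a i.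
have M0 : 0 <= M by exact: sumr_ge0.
have bounded k : a k <= M + e / 2.
  elim/ltn_ind: k => k IH; have [kK|kK] := ltnP k (K + t).
    apply: (@le_trans _ _ M); last by lra.
    by rewrite /M (bigD1 (Ordinal kK)) //= lerDl sumr_ge0.
  apply: le_trans (hK _ kK) _.
  have lt : (k - t < k)%N.
    by rewrite ltn_subrL t0 (leq_trans t0) // (leq_trans _ kK) // leq_addl.
  have := IH _ lt; nra.
have decay j k : (K + j * t <= k)%N -> a k <= c ^+ j * M + e / 2.
  elim: j k => [|j IH] k; first by rewrite expr0 mul1r.
  rewrite mulSn => kK.
  have kK' : (K + t <= k)%N by apply: leq_trans kK; rewrite addnA leq_addr.
  apply: le_trans (hK _ kK') _.
  have : (K + j * t <= k - t)%N.
    rewrite leq_subRL; first by rewrite addnCA.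
    by apply: leq_trans kK'; rewrite leq_addl.
  move=> /IH h; have := ler_wpM2l c0 h; rewrite exprS; lra.
have : (fun j => c ^+ j * M) @ \oo --> 0 * M.
  by apply: cvgMr_tmp; apply: cvg_expr; rewrite ger0_norm.
rewrite mul0r => /cvgrPdistC_le /(_ (e / 2)) /(_ (divr_gt0 e0 (ltr0n _ 2))) [j _ hj].
have {}hj : c ^+ j * M <= e / 2.
  by apply: le_trans (ler_norm _) _; have := hj j (leqnn j); rewrite subr0.
exists (K + j * t)%N => // k /= kK; apply: le_trans (decay _ _ kK) _; lra.
Qed.

End RelaxedUpdates.

(** * Convergence of the J-symmetric updates *)

Section JSymmetricUpdates.
Context {R : realType} {n m : nat}.
Local Notation N := (n + m)%N.
Local Notation V := 'cV[R]_N.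
Local Notation mat := 'M[R]_N.
Local Notation J := (@Jmx R n m).

(** Powell's symmetric Broyden correction, relaxed by b, for a step s and a
    residual q. *)
Definition psb_correction (b : R) (s q : V) : mat :=
  (b / dotm s s) *: (s *m q^T + q *m s^T)
  - (b ^+ 2 * dotm s q / dotm s s ^+ 2) *: (s *m s^T).

Lemma psb_correction_sym b s q : (psb_correction b s q)^T = psb_correction b s q.
Proof.
rewrite /psb_correction linearB !linearZ /= linearD /= !trmx_mul !trmxK.
by rewrite (addrC (q *m s^T)).
Qed.

(** The heart of the matter: for a symmetric error H, correcting by the exact
    residual - H s damps H on both sides, and the correction is linear in the
    residual.  The symmetry of H turns s (H s)^T into s s^T H. *)
Lemma psb_residual (H : mat) b s c : s != 0 -> H^T = H ->
  H + psb_correction b s (c - H *m s) =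
  damping b s *m H *m (damping b s)^T + psb_correction b s c.
Proof.
move=> s0 Hsym; have ss : dotm s s != 0.
  by rewrite -sqr_fnorm expf_neq0 // fnorm_eq0.
rewrite trmx_damping /damping mulmxBl mul1mx mulmxBr mulmx1 mulmxBl.
rewrite -!scalemxAl -!scalemxAr.
have -> : s *m s^T *m H = s *m (H *m s)^T by rewrite trmx_mul Hsym mulmxA.
have -> : s *m (H *m s)^T *m (s *m s^T) = dotm s (H *m s) *: (s *m s^T).
  by rewrite mulmxA mul_col_row_col dotmC -scalemxAl.
rewrite mulmxA /psb_correction linearB /= mulmxBr mulmxBl dotmBr.
rewrite !mulrBr !mulrBl.
set A1 := s *m c^T; set A2 := c *m s^T; set A3 := s *m _^T.
set A4 := H *m s *m s^T; set A5 := s *m s^T.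
set d := dotm s c; set h := dotm s (H *m s).
apply/matrixP => i j; rewrite !mxE; field.
exact: ss.
Qed.

(** The relative bound is 2 b + b^2, which is at most 7.41. *)
Lemma ler_fnorm_psb_correction b s c e : s != 0 -> 0 <= b <= 19 / 10 ->
  fnorm c <= e * fnorm s -> fnorm (psb_correction b s c) <= 8 * e.
Proof.
move=> s0 /andP[b0 b2] hc; have n0 : 0 < fnorm s by rewrite fnorm_gt0.
have e0 : 0 <= e by rewrite -(pmulr_lge0 _ n0); apply: le_trans (fnorm_ge0 c) hc.
rewrite /psb_correction -!sqr_fnorm; apply: le_trans (ler_fnormB _ _) _.
rewrite !fnormZ !normrM !normfV !normrX (ger0_norm b0) (gtr0_norm n0).
have h1 : fnorm (s *m c^T + c *m s^T) <= 2 * e * fnorm s ^+ 2.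
  apply: le_trans (ler_fnormD _ _) _.
  have := ler_fnormM s c^T; have := ler_fnormM c s^T; rewrite !fnormT.
  have := ler_wpM2l (ltW n0) hc; lra.
have h2 : fnorm (s *m s^T) <= fnorm s ^+ 2.
  by apply: le_trans (ler_fnormM _ _) _; rewrite fnormT.
have h3 : `|dotm s c| <= e * fnorm s ^+ 2.
  apply: le_trans (norm_dotm_le _ _) _.
  by have := ler_wpM2l (ltW n0) hc; lra.
apply: (@le_trans _ _ (2 * b * e + b ^+ 2 * e)).
  apply: lerD.
    apply: le_trans (ler_wpM2l _ h1) _; first by rewrite divr_ge0 // exprn_ge0 // ltW.
    by rewrite le_eqVlt; apply/orP; left; apply/eqP; field; rewrite gt_eqF.
  apply: (@le_trans _ _ (b ^+ 2 * (e * fnorm s ^+ 2) / (fnorm s ^+ 2) ^+ 2 * fnorm s ^+ 2)).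
    apply: ler_pM => //; rewrite ?fnorm_ge0 //.
      by rewrite !mulr_ge0 ?invr_ge0 ?exprn_ge0 // ltW.
    by rewrite ler_wpM2r ?invr_ge0 ?sqr_ge0 // ler_wpM2l ?sqr_ge0.
  by rewrite le_eqVlt; apply/orP; left; apply/eqP; field; rewrite gt_eqF.
have : b ^+ 2 <= 4 by rewrite expr2; nra.
by move=> b4; have := ler_wpM2r e0 b4; have := ler_wpM2r e0 b2; lra.
Qed.

(** Multiplying by J turns the J-symmetric update of B into a relaxed symmetric
    Broyden update of J B. *)
Lemma B_update_psb (A B : mat) b s y :
  J *m (B_update B b s y - A) =
  J *m (B - A) + psb_correction b s (J *m (y - A *m s) - J *m (B - A) *m s).
Proof.
rewrite -mulmxA -mulmxBr.
have -> : y - A *m s - (B - A) *m s = y - B *m s.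
  by rewrite mulmxBl opprB addrA subrK.
rewrite /B_update; set r := y - B *m s.
rewrite addrAC (addrAC B) -addrA mulmxDr [X in _ + X = _]mulmxBr -!scalemxAr.
rewrite /psb_correction !dotvE dotm_mul trmx_Jmx; congr (_ + (_ *: _ - _ *: _)).
  by rewrite mulmxDr !mulmxA mul_Jmx_Jmx mul1mx trmx_mul trmx_Jmx mulmxA.
by rewrite !mulmxA mul_Jmx_Jmx mul1mx.
Qed.

(** The maximum over an empty window is 0, so a positive lower bound makes
    windows nonempty and is reached by one of their terms. *)
Lemma uniformly_independent_window (s : nat -> V) : uniformly_independent s ->
  exists (d : R) (k0 t : nat), [/\ 0 < d, (0 < t)%N &
    forall k (x : V), (k0 < k)%N -> fnorm x = 1 ->
      exists2 i, (i < t)%N &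
        d <= `|dotm x ((fnorm (s (k + i)%N))^-1 *: s (k + i)%N)|].
Proof.
move=> [s0 [_ [d [k0 [t [d0 _ hd]]]]]].
have hd' k (x : V) : (k0 < k)%N -> fnorm x = 1 ->
    exists2 i, (i < t)%N &
      d <= `|dotm x ((fnorm (s (k + i)%N))^-1 *: s (k + i)%N)|.
  case: k => // k kk0 x1; have := hd k x kk0; rewrite enormE => /(_ x1).
  rewrite -{1}[k.+1]add0n big_addn subSS addKn big_mkord => /bigmax_geP [|[i _]].
    by rewrite leNgt d0.
  by rewrite dotvE enormE (addnC i) => di; exists i.
exists d, k0, t; split=> //.
have [|i it _] := hd' k0.+1 ((fnorm (s 0%N))^-1 *: s 0%N) (ltnSn _).
  by rewrite fnormZ normfV gtr0_norm ?fnorm_gt0 // mulVf // fnorm_eq0.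
by apply: leq_trans it.
Qed.

(** The error H = J (B - A) is damped on both sides at each step, up to a
    perturbation of the relative size of the secant residual y - A s; over a
    window of steps the damping is a strict contraction. *)
Lemma jsym_updates_converge (A : mat) (s y : nat -> V) (B : nat -> mat)
  (b : nat -> R) :
  (J *m A)^T = J *m A -> (J *m B 0%N)^T = J *m B 0%N ->
  (forall k, 1 / 10 <= b k <= 19 / 10) -> uniformly_independent s ->
  (forall k, B k.+1 = B_update (B k) (b k) (s k) (y k)) ->
  (forall e, 0 < e -> \forall k \near \oo,
     fnorm (y k - A *m s k) <= e * fnorm (s k)) ->
  forall e, 0 < e -> \forall k \near \oo, fnorm (B k - A) <= e.
Proof.
move=> Asym B0sym hb hind BS hy.
have s0 := hind.1; have [d [k0 [t [d0 t0 hd]]]] := uniformly_independent_window hind.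
pose H k := J *m (B k - A); pose E k := psb_correction (b k) (s k) (J *m (y k - A *m s k)).
have HS' k : H k.+1 =
    H k + psb_correction (b k) (s k) (J *m (y k - A *m s k) - H k *m s k).
  by rewrite /H BS B_update_psb.
have Hsym k : (H k)^T = H k.
  elim: k => [|k IH]; first by rewrite /H mulmxBr linearB /= Asym B0sym.
  by rewrite HS' linearD /= psb_correction_sym IH.
have HS k : H k.+1 = damping (b k) (s k) *m H k *m (damping (b k) (s k))^T + E k.
  by rewrite HS' psb_residual.
have j0 : 0 < fnorm J + 1 by rewrite ltr_wpDl // fnorm_ge0.
have Esmall e : 0 < e -> exists K, forall j, (K <= j)%N -> fnorm (E j) <= e.
  move=> e0; have e'0 : 0 < e / (8 * (fnorm J + 1)).
    by rewrite divr_gt0 // mulr_gt0.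
  have [K _ hK] := hy _ e'0; exists K => j Kj.
  have -> : e = 8 * (e / 8) by field.
  apply: ler_fnorm_psb_correction => //.
    by have /andP[h1 ->] := hb j; rewrite andbT; apply: le_trans h1.
  apply: le_trans (ler_fnormM _ _) _.
  apply: le_trans (ler_wpM2l (fnorm_ge0 _) (hK j Kj)) _.
  rewrite mulrA ler_wpM2r ?fnorm_ge0 //.
  have -> : e / 8 = (fnorm J + 1) * (e / (8 * (fnorm J + 1))).
    by field; exact: lt0r_neq0.
  by rewrite ler_wpM2r ?(ltW e'0) // lerDl.
pose c : R := Num.max 0 (1 - 19 / 1600 * d ^+ 2 / t%:R).
have c01 : 0 <= c < 1.
  have gain0 : 0 < 19 / 1600 * d ^+ 2 / t%:R.
    apply: divr_gt0; last by rewrite ltr0n.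
    by apply: mulr_gt0; [lra|exact: exprn_gt0].
  by rewrite le_max lexx /= gt_max ltr01 /= ltrBlDr ltrDl.
have contract k (X : mat) : (k0 < k)%N ->
    fnorm (damping_window b s k t *m X) ^+ 2 <= c * fnorm X ^+ 2.
  move=> kk0; rewrite (sqr_fnorm_col (_ *m _)) (sqr_fnorm_col X) mulr_sumr.
  apply: ler_sum => j _; rewrite colE -mulmxA -colE.
  apply: le_trans (damping_window_contracts hb s0 t0 d0 _ _) _.
    by move=> x; exact: hd.
  by rewrite ler_wpM2r ?sqr_ge0 // le_max lexx orbT.
have conj_contract k (X : mat) : (k0 < k)%N ->
    fnorm (damping_window b s k t *m X *m (damping_window b s k t)^T) <= c * fnorm X.
  move=> kk0; have /andP[c0 _] := c01; set P := damping_window b s k t.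
  have -> : P *m X *m P^T = (P *m (P *m X)^T)^T by rewrite trmx_mul trmxK.
  rewrite fnormT -ler_sqr ?nnegrE ?mulr_ge0 ?fnorm_ge0 // exprMn.
  apply: le_trans (contract _ _ kk0) _; rewrite fnormT expr2 -mulrA.
  by rewrite ler_wpM2l // contract.
have Hsmall : forall e, 0 < e -> \forall k \near \oo, fnorm (H k) <= e.
  apply: (delayed_contraction_to0 (c := c) (t := t)) => // [k|e e0]; first exact: fnorm_ge0.
  have t0' : 0 < t%:R :> R by rewrite ltr0n.
  have [K hK] := Esmall _ (divr_gt0 e0 t0').
  exists (maxn K k0.+1) => // k /=; rewrite geq_max => /andP[Kk kk0].
  have := window_recursion hb s0 t HS (fun j kj => hK j (leq_trans Kk kj)).
  rewrite mulrC divfK ?gt_eqF // => h; have := conj_contract k (H k) kk0.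
  set X := _ *m _^T in h *; move=> h'.
  by rewrite -[H _](subrK X); apply: le_trans (ler_fnormD _ _) _; rewrite addrC lerD.
move=> e e0; apply: filterS (Hsmall _ (divr_gt0 e0 j0)) => k hk.
have -> : B k - A = J *m H k by rewrite /H mulmxA mul_Jmx_Jmx mul1mx.
apply: le_trans (ler_fnormM _ _) _; apply: le_trans (ler_wpM2l (fnorm_ge0 _) hk) _.
rewrite mulrA ler_pdivrMr // mulrC ler_wpM2l ?(ltW e0) // lerDl //.
Qed.

End JSymmetricUpdates.

(** * One trust-region step near a regular zero *)

Section TrustRegionStep.
Context {R : realType} {n m : nat}.
Local Notation N := (n + m)%N.
Local Notation V := 'cV[R]_N.
Local Notation mat := 'M[R]_N.

(** Stating invertibility as a lower bound on |B v| avoids the continuity of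
    matrix inversion, and it transfers to transposes. *)
Lemma perturbed_inverse (A B : mat) (c h : R) : A \in unitmx ->
  fnorm (invmx A) <= c -> fnorm (B - A) <= h -> c * h <= 1 / 2 ->
  forall v : V, fnorm v <= 2 * c * fnorm (B *m v).
Proof.
move=> Au hc hh ch v.
have c0 : 0 <= c by exact: le_trans (fnorm_ge0 _) hc.
have h1 : fnorm v <= c * fnorm (A *m v).
  rewrite -{1}[v](mulKmx Au); apply: le_trans (ler_fnormM _ _) _.
  by rewrite ler_wpM2r // fnorm_ge0.
have h2 : fnorm (A *m v) <= fnorm (B *m v) + h * fnorm v.
  have -> : A *m v = B *m v - (B - A) *m v by rewrite mulmxBl opprB addrCA subrr addr0.
  apply: le_trans (ler_fnormB _ _) _; rewrite lerD2l.
  by apply: le_trans (ler_fnormM _ _) _; rewrite ler_wpM2r // fnorm_ge0.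
have := ler_wpM2l c0 h2; have := ler_wpM2r (fnorm_ge0 v) ch; lra.
Qed.

Section Dogleg.
Context {B : mat} {g : V} {c d : R}.
Hypothesis Bu : B \in unitmx.
Hypothesis c1 : 1 <= c.
Hypothesis d1 : 1 <= d.
Hypothesis hB : forall v : V, fnorm v <= c * fnorm (B *m v).
Hypothesis hBT : forall v : V, fnorm v <= c * fnorm (B^T *m v).
Hypothesis hBd : fnorm B <= d.

(** In terms of u = B^-T g the model is |B s + u|^2 / 2 up to a constant, and
    the full step is the solution of B s = - u. *)
Definition dual_gradient : V := (invmx B)^T *m g.

Local Notation u := dual_gradient.

Lemma trmx_mul_dual_gradient : B^T *m u = g.
Proof. by rewrite /u mulmxA -trmx_mul mulVmx // trmx1 mul1mx. Qed.

Lemma mul_step_B : B *m step_B g B = - u.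
Proof. by rewrite /step_B mulmxN -[_ *m g]mulmxA mulKVmx. Qed.

Lemma model_decrease (F s : V) :
  model F g B 0 - model F g B s = (fnorm u ^+ 2 - fnorm (B *m s + u) ^+ 2) / 2.
Proof.
have dot0 (x : V) : dotm x 0 = 0 by rewrite /dotm mulmx0 mxtrace0.
rewrite /model !mulmx0 !dotvE !dot0 -mulmxA [dotm s _]dotmC dotm_mul trmxK.
have -> : dotm g s = dotm u (B *m s) by rewrite -[B in RHS]trmxK -dotm_mul trmx_mul_dual_gradient.
rewrite !sqr_fnorm dotmDl !dotmDr (dotmC u (B *m s)); lra.
Qed.

Lemma step_B_bound : fnorm (step_B g B) <= c ^+ 2 * fnorm g.
Proof.
apply: le_trans (hB _) _; rewrite mul_step_B fnormN expr2 -mulrA.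
rewrite ler_wpM2l ?(le_trans ler01 c1) //.
by have := hBT u; rewrite trmx_mul_dual_gradient.
Qed.

(** The one-dimensional minimization behind the Cauchy point: up to the
    minimizer of the model along - g, the decrease is at least half the linear
    one.  If the trust region does not cut the Cauchy point short, its length
    is comparable to that of g. *)
Lemma step_C_decrease (Delta : R) : 0 < Delta -> g != 0 ->
  let pC := step_C g B Delta in
  [/\ fnorm pC <= Delta,
      fnorm g * fnorm pC <= fnorm u ^+ 2 - fnorm (B *m pC + u) ^+ 2
    & fnorm pC < Delta -> fnorm g <= d ^+ 2 * fnorm pC].
Proof.
move=> D0 g0; have n0 : 0 < fnorm g by rewrite fnorm_gt0.
have Bg0 : 0 < fnorm (B *m g).
  by have := hB g; rewrite -(pmulr_rgt0 _ (lt_le_trans ltr01 c1)); apply: lt_le_trans.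
rewrite /step_C !enormE dotvE -mulmxA -dotm_mul -sqr_fnorm /=.
set T := Num.min _ _.
have T0 : 0 <= T by rewrite le_min !divr_ge0 ?sqr_ge0 ?ltW.
have -> : fnorm (- (T *: g)) = T * fnorm g by rewrite fnormN fnormZ ger0_norm.
have TBg : T * fnorm (B *m g) ^+ 2 <= fnorm g ^+ 2.
  by rewrite -ler_pdivlMr ?exprn_gt0 // ge_min lexx.
split.
- by rewrite -ler_pdivlMr // ge_min lexx orbT.
- rewrite mulmxN -scalemxAr [- _ + _]addrC !sqr_fnorm dotmBl !dotmBr.
  have ug : dotm (B *m g) u = dotm g g by rewrite dotm_mul trmx_mul_dual_gradient.
  rewrite !dotmZl !dotmZr (dotmC u) ug -!sqr_fnorm.
  by have := ler_wpM2l T0 TBg; lra.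
- rewrite -ltr_pdivlMr // gt_min ltxx orbF => hlt.
  have -> : T = fnorm g ^+ 2 / fnorm (B *m g) ^+ 2 by rewrite /T min_l // ltW.
  have Bgd : fnorm (B *m g) ^+ 2 <= d ^+ 2 * fnorm g ^+ 2.
    rewrite -exprMn ler_sqr ?nnegrE ?mulr_ge0 ?fnorm_ge0 ?(le_trans ler01 d1) //.
    by apply: le_trans (ler_fnormM _ _) _; rewrite ler_wpM2r // fnorm_ge0.
  have -> : d ^+ 2 * (fnorm g ^+ 2 / fnorm (B *m g) ^+ 2 * fnorm g) =
      d ^+ 2 * fnorm g ^+ 2 * fnorm g / fnorm (B *m g) ^+ 2.
    by field; rewrite gt_eqF.
  by rewrite ler_pdivlMr ?exprn_gt0 // [leLHS]mulrC ler_wpM2r // ltW.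
Qed.

(** All dogleg steps share one decrease estimate.  For the full step, the norms
    of s, g and u are comparable; the Cauchy step has it by construction; on
    the second leg B s + u is a contraction of its value at the Cauchy point,
    whose length is comparable to that of s. *)
Lemma dogleg_decrease (Delta : R) (F s : V) : 0 < Delta -> s != 0 ->
  dogleg_step g B Delta s ->
  [/\ fnorm s <= c ^+ 2 * fnorm g
    & fnorm g * fnorm s <=
        2 * c ^+ 2 * d ^+ 2 * (model F g B 0 - model F g B s)].
Proof.
move=> D0 s0 [full cauchy between].
have cc1 : 1 <= c ^+ 2 by rewrite exprn_ege1.
have dd1 : 1 <= d ^+ 2 by rewrite exprn_ege1.
have cd1 : 1 <= c ^+ 2 * d ^+ 2 by rewrite -exprMn exprn_ege1 // mulr_ege1.
rewrite !enormE in full cauchy between.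
set pB := step_B g B in full cauchy between *.
have hpB := step_B_bound.
have [/full sE|Delta_lt] := leP (fnorm pB) Delta.
  split; first by rewrite sE.
  rewrite model_decrease sE mul_step_B addNr fnorm0 expr0n subr0.
  have h1 : fnorm g <= d * fnorm u.
    rewrite -{1}trmx_mul_dual_gradient; apply: le_trans (ler_fnormM _ _) _.
    by rewrite fnormT ler_wpM2r // fnorm_ge0.
  have h2 : fnorm pB <= c * fnorm u.
    by apply: le_trans (hB _) _; rewrite mul_step_B fnormN.
  apply: le_trans (ler_pM (fnorm_ge0 _) (fnorm_ge0 _) h1 h2) _.
  have cd : d * c <= c ^+ 2 * d ^+ 2.
    by rewrite -exprMn mulrC ler_eXnr // mulr_ege1.
  by have := ler_wpM2r (sqr_ge0 (fnorm u)) cd; lra.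
have g0 : g != 0.
  apply/eqP => g0; move: Delta_lt; rewrite /pB /step_B g0 mulmx0 oppr0 fnorm0.
  by rewrite ltNge ltW.
have [pC_le pC_dec pC_long] := step_C_decrease D0 g0.
set pC := step_C g B Delta in cauchy between pC_le pC_dec pC_long.
have [pCE|pC_lt] := eqVneq (fnorm pC) Delta.
  rewrite (cauchy Delta_lt pCE); split; first by rewrite pCE (le_trans (ltW Delta_lt)).
  rewrite model_decrease.
  have P0 : 0 <= fnorm u ^+ 2 - fnorm (B *m pC + u) ^+ 2.
    by apply: le_trans pC_dec; rewrite mulr_ge0 // fnorm_ge0.
  by have := ler_wpM2r P0 cd1; lra.
have {}pC_lt : fnorm pC < Delta by rewrite lt_neqAle pC_lt.
have [alpha [/andP[al0 al1] sD sE]] := between Delta_lt pC_lt.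
rewrite -sE enormE in sD.
have s_le : fnorm s <= c ^+ 2 * fnorm g by rewrite sD (le_trans (ltW Delta_lt)).
split=> //; rewrite model_decrease.
have -> : B *m s + u = (1 - alpha) *: (B *m pC + u).
  rewrite sE mulmxDr -scalemxAr mulmxBr mul_step_B.
  by apply/matrixP => i j; rewrite !mxE; ring.
rewrite fnormZ exprMn real_normK ?num_real //.
set X := fnorm (_ + u) in pC_dec *.
have al2 : (1 - alpha) ^+ 2 <= 1 by rewrite expr_le1 //; lra.
have hX := ler_wpM2r (sqr_ge0 X) al2; rewrite mul1r in hX.
have long : fnorm s <= c ^+ 2 * d ^+ 2 * fnorm pC.
  apply: le_trans s_le _; rewrite -mulrA ler_wpM2l ?sqr_ge0 //.
  exact: pC_long.
apply: le_trans (ler_wpM2l (fnorm_ge0 _) long) _.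
have cd0 : 0 <= c ^+ 2 * d ^+ 2 by lra.
by have := ler_wpM2l cd0 (le_trans pC_dec (lerB (lexx _) hX)); lra.
Qed.

End Dogleg.

(** Actual and predicted reductions differ by the model error, of order
    h |s| (|F| + |s|), which is a small multiple of |g| |s| and hence of the
    predicted reduction. *)
Lemma ratio_close (F : V -> V) (B A Jk : mat) (z s : V) (h c d : R)
  (g := Jk^T *m F z) (y := F (z + s) - F z) :
  0 < h -> 1 <= c -> 1 <= d -> s != 0 ->
  (forall v : V, fnorm v <= c * fnorm (Jk^T *m v)) ->
  fnorm (B - A) <= h -> fnorm (Jk - A) <= h -> fnorm A + h <= d ->
  fnorm (y - A *m s) <= h * fnorm s ->
  fnorm s <= c ^+ 2 * fnorm g ->
  fnorm g * fnorm s <=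
    2 * c ^+ 2 * d ^+ 2 * (model (F z) g B 0 - model (F z) g B s) ->
  20 * h * c ^+ 4 * d ^+ 3 <= 1 ->
  3 / 5 <= reduction_ratio F g B z s.
Proof.
move=> h0 c1 d1 s0 hJ hB hJA hA hy hs hpred small.
have ns0 : 0 < fnorm s by rewrite fnorm_gt0.
set pred := model _ _ _ 0 - _ in hpred *.
have gs0 : 0 < fnorm g * fnorm s.
  rewrite mulr_gt0 // lt_neqAle fnorm_ge0 andbT eq_sym; apply/eqP => g0.
  by move: hs; rewrite g0 mulr0 leNgt ns0.
have cd0 : 0 < c ^+ 2 * d ^+ 2 by rewrite mulr_gt0 // exprn_gt0 //; lra.
have pred0 : 0 < pred.
  move: (lt_le_trans gs0 hpred); rewrite -(mulrA 2) pmulr_rgt0 //.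
  exact: mulr_gt0.
rewrite /reduction_ratio -/pred ler_pdivlMr // !enormE.
have FE : F (z + s) = F z + y by rewrite /y [RHS]addrC subrK.
clearbody y; have nd0 : 0 <= d by lra.
have nBs : fnorm (B *m s) <= d * fnorm s.
  apply: le_trans (ler_fnormM _ _) _; rewrite ler_wpM2r ?(ltW ns0) //.
  by have := ler_fnormD (B - A) A; rewrite subrK; lra.
have ny : fnorm y <= d * fnorm s.
  have := ler_fnormD (y - A *m s) (A *m s); rewrite subrK.
  have := ler_fnormM A s; have := ler_wpM2r (ltW ns0) hA; lra.
have yJ : fnorm (y - Jk *m s) <= 2 * h * fnorm s.
  have -> : y - Jk *m s = (y - A *m s) - (Jk - A) *m s.
    by rewrite mulmxBl opprB addrA subrK.
  have := ler_fnormB (y - A *m s) ((Jk - A) *m s).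
  have := ler_fnormM (Jk - A) s; have := ler_wpM2r (ltW ns0) hJA; lra.
have yB : fnorm (y - B *m s) <= 2 * h * fnorm s.
  have -> : y - B *m s = (y - A *m s) - (B - A) *m s.
    by rewrite mulmxBl opprB addrA subrK.
  have := ler_fnormB (y - A *m s) ((B - A) *m s).
  have := ler_fnormM (B - A) s; have := ler_wpM2r (ltW ns0) hB; lra.
have E : fnorm (F z) ^+ 2 / 2 - fnorm (F (z + s)) ^+ 2 / 2 =
    pred - dotm (F z) (y - Jk *m s) - dotm (y - B *m s) (y + B *m s) / 2.
  have dot0 (x : V) : dotm x 0 = 0 by rewrite /dotm mulmx0 mxtrace0.
  rewrite /pred /model !mulmx0 !dotvE !dot0 -mulmxA [dotm s _]dotmC dotm_mul trmxK.
  have -> : dotm g s = dotm (F z) (Jk *m s) by rewrite /g dotm_mul trmxK.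
  rewrite FE !sqr_fnorm; rewrite !(dotmDl, dotmDr, dotmBl, dotmBr).
  rewrite (dotmC y (F z)) (dotmC y (B *m s)) !(dotmNl, dotmNr); lra.
rewrite {}E.
have e1 := le_trans (ler_dotm (F z) (y - Jk *m s))
  (ler_pM (fnorm_ge0 _) (fnorm_ge0 _) (hJ (F z)) yJ).
have nyB : fnorm (y + B *m s) <= 2 * d * fnorm s.
  by have := ler_fnormD y (B *m s); lra.
have e2 := le_trans (ler_dotm (y - B *m s) (y + B *m s))
  (ler_pM (fnorm_ge0 _) (fnorm_ge0 _) yB nyB).
rewrite -/g in e1.
(* The sum of the error terms e1 and e2 is at most
   2 h (c + d c^2) |g| |s|, hence at most 4 h d c^2 |g| |s|. *)
have hds : h * d * fnorm s * fnorm s <= h * d * (c ^+ 2 * fnorm g) * fnorm s.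
  by rewrite ler_wpM2r ?(ltW ns0) // ler_wpM2l // mulr_ge0 // ltW.
have ccd : c <= d * c ^+ 2.
  by rewrite -[leLHS]mul1r; apply: ler_pM => //; [lra|rewrite ler_eXnr //].
have hccd : 2 * h * (c * (fnorm g * fnorm s)) <= 2 * h * (d * c ^+ 2 * (fnorm g * fnorm s)).
  by rewrite ler_wpM2l ?ler_wpM2r ?(ltW gs0) //; lra.
have k0 : 0 <= 4 * h * d * c ^+ 2.
  by rewrite !mulr_ge0 ?exprn_ge0 //; lra.
have hfin := ler_wpM2l k0 hpred.
have sm := ler_wpM2r (ltW pred0) small.
have -> : 3 / 5 * pred = pred - 2 / 5 * pred by field.
have : 4 * h * d * c ^+ 2 * (2 * c ^+ 2 * d ^+ 2 * pred) <= 2 / 5 * pred.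
  have -> : 4 * h * d * c ^+ 2 * (2 * c ^+ 2 * d ^+ 2 * pred) =
    2 / 5 * (20 * h * c ^+ 4 * d ^+ 3 * pred) by field.
  by rewrite -{2}[pred]mul1r ler_wpM2l.
lra.
Qed.

(** With B and Jk close to A, u = B^-T Jk^T F is close to F, which is close to
    A e; so the full step - B^-1 u is close to - e. *)
Lemma newton_error (B A Jk : mat) (F e : V) (h c d : R) (g := Jk^T *m F) :
  0 <= c -> B \in unitmx ->
  (forall v : V, fnorm v <= c * fnorm (B *m v)) ->
  (forall v : V, fnorm v <= c * fnorm (B^T *m v)) ->
  fnorm (B - A) <= h -> fnorm (Jk - A) <= h -> fnorm A + h <= d ->
  fnorm (F - A *m e) <= h * fnorm e ->
  fnorm (e + step_B g B) <= 2 * c * (1 + c * d) * h * fnorm e.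
Proof.
move=> c0 Bu hB hBT hBA hJA hA hF.
have h0 : 0 <= h by exact: le_trans (fnorm_ge0 _) hBA.
have nF : fnorm F <= d * fnorm e.
  have := ler_fnormD (F - A *m e) (A *m e); rewrite subrK.
  have := ler_fnormM A e; have := ler_wpM2r (fnorm_ge0 e) hA; lra.
set u := @dual_gradient B g.
have uF : fnorm (u - F) <= 2 * c * h * d * fnorm e.
  apply: le_trans (hBT _) _.
  rewrite mulmxBr (trmx_mul_dual_gradient Bu) -mulmxBl.
  have JB : fnorm (Jk^T - B^T) <= 2 * h.
    rewrite -linearB /= fnormT.
    have -> : Jk - B = (Jk - A) - (B - A) by rewrite opprB addrA subrK.
    by have := ler_fnormB (Jk - A) (B - A); lra.
  have := le_trans (ler_fnormM _ _) (ler_pM (fnorm_ge0 _) (fnorm_ge0 _) JB nF).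
  by move=> /(ler_wpM2l c0); lra.
apply: le_trans (hB _) _; rewrite mulmxDr mul_step_B // -/u.
have -> : B *m e - u = (B - A) *m e - (F - A *m e) - (u - F).
  by rewrite mulmxBl; apply/matrixP => i j; rewrite !mxE; ring.
have t1 := ler_fnormB ((B - A) *m e - (F - A *m e)) (u - F).
have t2 := ler_fnormB ((B - A) *m e) (F - A *m e).
have t3 := ler_fnormM (B - A) e; have t4 := ler_wpM2r (fnorm_ge0 e) hBA.
have : fnorm ((B - A) *m e - (F - A *m e) - (u - F)) <=
  2 * h * fnorm e + 2 * c * h * d * fnorm e by lra.
by move=> /(ler_wpM2l c0); lra.
Qed.

End TrustRegionStep.

(** * Convergence of a run *)

Section RSuperlinear.
Context {R : realType}.

(** Ratios eventually below e / 2 give a k <= C (e / 2)^k, and the constant C is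
    eventually absorbed by 2^k. *)
Lemma Q_superlinear_root_cvg0 (a : nat -> R) : (forall k, 0 <= a k) ->
  (forall e, 0 < e -> \forall k \near \oo, a k.+1 <= e * a k) ->
  a k `^ (k%:R^-1) @[k --> \oo] --> (0 : R).
Proof.
move=> a0 ha; apply/cvgrPdistC_le => e e0.
have q0 : 0 < e / 2 by rewrite divr_gt0.
have [K _ hK] := ha _ q0.
have geometric j : a (K + j)%N <= (e / 2) ^+ j * a K.
  elim: j => [|j IH]; first by rewrite addn0 expr0 mul1r.
  rewrite addnS exprS -mulrA; apply: le_trans (hK _ (leq_addr _ _)) _.
  by rewrite ler_wpM2l // ltW.
pose C := a K / (e / 2) ^+ K.
have bound k : (K <= k)%N -> a k <= (e / 2) ^+ k * C.
  move=> Kk; rewrite -{1}(subnKC Kk); apply: le_trans (geometric _) _.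
  rewrite -[in leRHS](subnK Kk) exprD /C -mulrA [_ ^+ K * _]mulrC.
  by rewrite divfK // expf_neq0 // gt_eqF.
have : (fun k => (1 / 2 : R) ^+ k * C) @ \oo --> 0 * C.
  by apply: cvgMr_tmp; apply: cvg_expr; rewrite ger0_norm //; lra.
rewrite mul0r => /cvgrPdistC_le /(_ 1 ltr01) [K' _ hK'].
exists (maxn K K').+1 => // k /=; rewrite gtn_max => /andP[Kk K'k].
have k0 : (0 < k)%N by apply: leq_ltn_trans Kk.
rewrite subr0 ger0_norm ?powR_ge0 //.
have -> : e = (e ^+ k) `^ (k%:R^-1).
  rewrite -powR_mulrn ?ltW // -powRrM divff ?powRr1 ?ltW //.
  by rewrite pnatr_eq0 -lt0n.
apply: ge0_ler_powR; rewrite ?nnegrE ?invr_ge0 ?exprn_ge0 ?(ltW e0) //.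
apply: le_trans (bound _ (ltnW Kk)) _.
have -> : e ^+ k = (e / 2) ^+ k * 2 ^+ k.
  by rewrite -exprMn divfK.
rewrite ler_wpM2l ?exprn_ge0 ?(ltW q0) //.
have := le_trans (ler_norm _) (hK' k (ltnW K'k)); rewrite subr0 mul1r exprVn.
by rewrite ler_pdivrMl ?exprn_gt0 // mulr1.
Qed.

End RSuperlinear.

Section Run.
Context {R : realType} {n m : nat}.
Local Notation V := 'cV[R]_(n + m).
Local Notation mat := 'M[R]_(n + m).
Context {F : V -> V} {z0 : V} {B0 : mat} {R0 Delta0 zeta : R}
  {z s : nat -> V} {B : nat -> mat} {Delta beta : nat -> R} {zs : V}.
Hypothesis hrun : algorithm_run F z0 B0 R0 Delta0 zeta z s B Delta beta.
Hypothesis hF : C1map F.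
Hypothesis Fzs : F zs = 0.
Hypothesis hz : z k @[k --> \oo] --> zs.
Hypothesis hs : s k @[k --> \oo] --> (0 : V).
Hypothesis s0 : forall k, s k != 0.
Local Notation A := (jac F zs).
Local Notation g k := ((jac F (z k))^T *m F (z k)).

Lemma run_Delta_bounds k : 0 < Delta k <= R0.
Proof.
have R00 := run_R0 hrun.
elim: k => [|k /andP[D0 DR]].
  by have [_ _ ->] := run_init hrun; exact: run_Delta0 hrun.
have [_ -> _ _] := run_step hrun k; case: ifP => _.
  by rewrite divr_gt0 //= ler_pdivrMr //; lra.
by rewrite lt_min R00 mulr_gt0 //= ge_min lexx orbT.
Qed.

Lemma run_secant_error (e : R) : 0 < e -> \forall k \near \oo,
  fnorm (F (z k + s k) - F (z k) - A *m s k) <= e * fnorm (s k).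
Proof. exact: C1map_linearization. Qed.

Lemma run_value_error (e : R) : 0 < e -> \forall k \near \oo,
  fnorm (F (z k) - A *m (z k - zs)) <= e * fnorm (z k - zs).
Proof.
move=> e0; have hd : z k - zs @[k --> \oo] --> (0 : V).
  by rewrite -(subrr zs); apply: cvgB => //; exact: cvg_cst.
have hc : (fun=> zs) k @[k --> \oo] --> zs by exact: cvg_cst.
have h := C1map_linearization hF hc hd e0.
apply: filterS h => k /=; by rewrite Fzs subr0 (addrC zs) subrK.
Qed.

Lemma run_jac_error (e : R) : 0 < e -> \forall k \near \oo,
  fnorm (jac F (z k) - A) <= e.
Proof. exact: (cvg_fnorm _ _).1 (C1map_continuous_jac hF hz) e. Qed.

Hypothesis Au : A \in unitmx.
Hypothesis hB : forall e, 0 < e -> \forall k \near \oo, fnorm (B k - A) <= e.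

(* c bounds the inverses of all matrices close to A and d their norms; the
   estimates on a step are used with these two constants. *)
Let c0 : R := Num.max 1 (fnorm (invmx A)).
Let c : R := 2 * c0.
Let d : R := fnorm A + 2.

Let c0_ge1 : 1 <= c0. Proof. by rewrite le_max lexx. Qed.
Let c_ge1 : 1 <= c. Proof. by have := c0_ge1; rewrite /c; lra. Qed.
Let d_ge1 : 1 <= d. Proof. by have := fnorm_ge0 A; rewrite /d; lra. Qed.

Let near_inverse h (M : mat) : fnorm (M - A) <= h -> c0 * h <= 1 / 2 ->
  (forall v : V, fnorm v <= c * fnorm (M *m v)) /\
  (forall v : V, fnorm v <= c * fnorm (M^T *m v)).
Proof.
move=> Mh ch; have cA : fnorm (invmx A) <= c0 by rewrite le_max lexx orbT.
split; first exact: (perturbed_inverse Au cA Mh ch).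
apply: (perturbed_inverse (A := A^T) _ _ _ ch); first by rewrite unitmx_tr.
  by rewrite -trmx_inv fnormT.
by rewrite -linearB /= fnormT.
Qed.

Let run_accuracy h : 0 < h -> h <= 1 -> c0 * h <= 1 / 2 -> \forall k \near \oo,
  fnorm (step_B (g k) (B k) + (z k - zs)) <= 2 * c * (1 + c * d) * h * fnorm (z k - zs).
Proof.
move=> h0 h1 ch; move: (hB h0) (run_jac_error h0) (run_value_error h0).
apply: filterS3 => k hBk hJk hFk.
have [b1 b2] := near_inverse hBk ch; rewrite addrC.
apply: newton_error hFk => //; first by have := c_ge1; lra.
  exact: run_B_unit hrun k.
by rewrite /d; lra.
Qed.

(** The errors of the secant, of the Jacobian at z k and of B k are eventually
    below any threshold, so that [ratio_close] applies; from then on steps are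
    accepted and radii are not reduced. *)
Let run_very_successful : \forall k \near \oo,
  3 / 5 <= reduction_ratio F (g k) (B k) (z k) (s k).
Proof.
(* The largest matrix error for which a reduction ratio of 3 / 5 is
   guaranteed. *)
pose h := (20 * c ^+ 4 * d ^+ 3)^-1.
have c40 : 1 <= c ^+ 4 by rewrite exprn_ege1.
have d30 : 1 <= d ^+ 3 by rewrite exprn_ege1.
have cd0 : 1 <= c ^+ 4 * d ^+ 3 by rewrite mulr_ege1.
have h0 : 0 < h by rewrite invr_gt0 -mulrA mulr_gt0 // (lt_le_trans ltr01).
have hE : 20 * h * c ^+ 4 * d ^+ 3 = 1.
  rewrite /h; field; apply/andP; split; rewrite gt_eqF // (lt_le_trans ltr01) //.
have ch : c0 * h <= 1 / 2.
  have c4c : c <= c ^+ 4 * d ^+ 3.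
    apply: (@le_trans _ _ (c ^+ 4)); first by rewrite ler_eXnr.
    by rewrite ler_peMr // (le_trans ler01).
  have -> : c0 * h = c * h / 2 by rewrite /c; field.
  by have := ler_wpM2l (ltW h0) c4c; lra.
have h1 : h <= 1 by have := ler_wpM2l (ltW h0) cd0; lra.
move: (hB h0) (run_jac_error h0) (run_secant_error h0).
apply: filterS3 => k hBk hJk hsk.
have [b1 b2] := near_inverse hBk ch; have [_ j2] := near_inverse hJk ch.
have [hdog _ _ _] := run_step hrun k; have /andP[D0 _] := run_Delta_bounds k.
have Bd : fnorm (B k) <= d.
  by have := ler_fnormD (B k - A) A; rewrite subrK /d; lra.
have [s_le pred] :=
  dogleg_decrease (run_B_unit hrun k) c_ge1 d_ge1 b1 b2 Bd (F (z k)) D0 (s0 k) hdog.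
apply: (ratio_close h0 c_ge1 d_ge1 (s0 k) j2 hBk hJk _ hsk s_le pred).
  by rewrite /d; lra.
by rewrite hE.
Qed.

(** Eventually the radii are bounded below while the full steps tend to 0, so
    the full steps are taken, and these are nearly Newton steps. *)
Lemma run_Q_superlinear (e : R) : 0 < e -> \forall k \near \oo,
  fnorm (z k.+1 - zs) <= e * fnorm (z k - zs).
Proof.
have [K _ hK] := run_very_successful.
have moves k : (K <= k)%N -> z k.+1 = z k + s k.
  move=> /hK /= rho; have [_ _ -> _] := run_step hrun k.
  have /andP[_ zeta_lt] := run_zeta hrun.
  rewrite ifT //; apply: le_trans rho; apply: le_trans (ltW zeta_lt) _; lra.
have expands k : (K <= k)%N -> Delta k <= Delta k.+1.
  move=> /hK /= rho; have [_ -> _ _] := run_step hrun k.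
  have /andP[D0 DR] := run_Delta_bounds k.
  rewrite ifF; first by rewrite le_min DR andbT; lra.
  by apply/negbTE; rewrite -ltNge; apply: lt_le_trans rho; lra.
have Delta_ge k : (K <= k)%N -> Delta K <= Delta k.
  move=> /subnKC <-; elim: (k - K)%N => [|j IH]; first by rewrite addn0.
  by rewrite addnS (le_trans IH) // expands // leq_addr.
have /andP[DK0 _] := run_Delta_bounds K.
pose M := 2 * c * (1 + c * d).
have M0 : 0 < M.
  have cd0 : 0 <= c * d by apply: mulr_ge0; have := c_ge1; have := d_ge1; lra.
  by apply: mulr_gt0; last lra; have := c_ge1; lra.
have acc e' : 0 < e' -> \forall k \near \oo,
    fnorm (step_B (g k) (B k) + (z k - zs)) <= e' * fnorm (z k - zs).
  move=> e'0; pose h := Num.min (e' / M) (Num.min 1 (1 / 2 / c0)).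
  have c00 : 0 < c0 := lt_le_trans ltr01 c0_ge1.
  have h0 : 0 < h by rewrite !lt_min ltr01 !divr_gt0.
  have h1 : h <= 1 by rewrite !ge_min lexx orbT.
  have ch : c0 * h <= 1 / 2 by rewrite mulrC -ler_pdivlMr // !ge_min lexx !orbT.
  apply: filterS (run_accuracy h0 h1 ch) => k hk; apply: le_trans hk _.
  rewrite ler_wpM2r ?fnorm_ge0 // mulrC -ler_pdivlMr //; by rewrite !ge_min lexx.
have full : \forall k \near \oo, s k = step_B (g k) (B k).
  have hd : \forall k \near \oo, fnorm (z k - zs) <= Delta K / 2.
    exact: (cvg_fnorm _ _).1 hz _ (divr_gt0 DK0 (ltr0n R 2)).
  have Kle : \forall k \near \oo, (K <= k)%N by exists K.
  move: hd (acc 1 ltr01) Kle; apply: filterS3 => k hk pk Kk.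
  have [[hfull _ _] _ _ _] := run_step hrun k; apply: hfull; rewrite enormE.
  apply: le_trans (Delta_ge _ Kk).
  have := ler_fnormB (step_B (g k) (B k) + (z k - zs)) (z k - zs).
  by rewrite addrK; lra.
move=> e0; have Kle : \forall k \near \oo, (K <= k)%N by exists K.
move: full (acc e e0) Kle; apply: filterS3 => k sE pk Kk.
by rewrite moves // sE addrAC addrC.
Qed.

End Run.

Unset Implicit Arguments.
Set Strict Implicit.

Theorem theorem4p3 (R : realType) (n m : nat)
  (L : 'cV[R]_n -> 'cV[R]_m -> R)
  (hL : times_differentiable 3 (uncurryL L))
  (z0 : 'cV[R]_(n + m)) (B0 : 'M[R]_(n + m)) (R0 Delta0 zeta : R)
  (z s : nat -> 'cV[R]_(n + m)) (B : nat -> 'M[R]_(n + m))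
  (Delta beta : nat -> R)
  (hrun : algorithm_run (minimaxF L) z0 B0 R0 Delta0 zeta z s B Delta beta)
  (hLip : lipschitz_on_level_nbhds (minimaxF L) z0)
  (hreg : regular_saddle_points (minimaxF L))
  (hind : uniformly_independent s)
  (zstar : 'cV[R]_(n + m)) (hzstar : minimaxF L zstar = 0)
  (hz : z k @[k --> \oo] --> zstar)
  (hs : s k @[k --> \oo] --> (0 : 'cV[R]_(n + m))) :
  (B k @[k --> \oo] --> jac (minimaxF L) zstar) /\
  R_superlinear z zstar.
Proof.
have hF := C1map_minimaxF hL.
have hB : forall e, 0 < e ->
    \forall k \near \oo, fnorm (B k - jac (minimaxF L) zstar) <= e.
  apply: (jsym_updates_converge
    (y := fun k => minimaxF L (z k + s k) - minimaxF L (z k)) (b := beta) _ _ _ hind).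
  - exact: jac_minimaxF_sym.
  - have [_ -> _] := run_init hrun.
    rewrite trmx_mul trmx_Jmx {2}(run_B0_Jsym hrun) !mulmxA mul_Jmx_Jmx.
    by rewrite mul1mx.
  - by move=> k; have := run_beta hrun k; rewrite /beta_hat; lra.
  - by move=> k; have [] := run_step hrun k.
  - by move=> e; exact: (run_secant_error hF hz hs).
split; first exact/cvg_fnorm.
have [_ hunit _] := hreg.
rewrite /R_superlinear.
have -> : (fun k => enorm (z k - zstar) `^ k%:R^-1) =
    (fun k => fnorm (z k - zstar) `^ k%:R^-1).
  by apply/funext => k; rewrite enormE.
apply: Q_superlinear_root_cvg0 => [k|e e0]; first exact: fnorm_ge0.
exact: (run_Q_superlinear hrun hF hzstar hz hs hind.1 (hunit _ hzstar) hB).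
Qed.
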